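(* Let $n\ge1$. For any $\tau_1,\ldots,\tau_n\in[0,r]$, letting $\widehat\tau_\pi:=\min_{i\in\pi}\tau_i$ for $\pi\subset\{1,\ldots,n\}$, we have $$\mathbb E[\sigma_k(kr-\tau_1)\cdots\sigma_k(kr-\tau_n)]=\sum_{\pi^1,\ldots,\pi^{k-1}\in\Pi[n]}\int_{\prod_{l=1}^{k-1}\prod_{j=1}^{|\pi^l|}[0,\widehat\tau_{\pi^l_j}]}\ \prod_{\substack{1\le l<k\\ 1\le j\le|\pi^l|\\ i\in\pi^l_j}}\mathbf 1_{\{z^1_{\zeta^1_i}<\cdots<z^{k-1}_{\zeta^{k-1}_i}\}}\ \lambda_1(dz^1_{\pi^1})\cdots\lambda_{k-1}(dz^{k-1}_{\pi^{k-1}}),$$ where $\pi^l=\{\pi^l_1,\ldots,\pi^l_{|\pi^l|}\}$, $\zeta^j_i$ denotes the block of $\pi^j$ that contains the index $i\in\{1,\ldots,n\}$, and $dz^j_{\pi^j}:=(dz^j_i)_{i\in\pi^j}$, $j=1,\ldots,k-1$, i.e. there is one integration variable $z^j_i$ for each block $i$ of $\pi^j$.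
   Context: $\Pi[n]$ is the set of partitions of $\{1,\ldots,n\}$. Let $k\ge2$ and let $r>0$ be the connection radius of the one-dimensional unit disk random graph. Nodes are distributed on $[0,kr]$ according to a Poisson point process with intensity $\lambda(ds)=\sum_{l=1}^k\mathbf 1_{((l-1)r,lr]}(s)\,\lambda_l((l-1)r+ds)$, where $\lambda_l(ds)=\lambda_l(s)ds$, $l=1,\ldots,k$, are absolutely continuous intensity measures on $[0,r]$; that is, the intensity on the cell $((l-1)r,lr]$ is $\lambda_l$ with coordinate measured from the left endpoint $(l-1)r$. Additional nodes are located at $0$ and at $t\in[0,kr]$. Two nodes $s,t$ are connected if and only if $|t-s|\le r$. $\sigma_k(t)$ denotes the count of $k$-hops between the nodes at $0$ and $t$, a $k$-hop being a path made of $k$ edges that links $0$ to $t$ through $k-1$ nodes of the Poisson process. The counts for different endpoints $t$ are computed from the same Poisson process. In the product measure, $\lambda_l(dz^l_{\pi^l})$ stands for the product of the measures $\lambda_l$ in the variables indexed by the blocks of $\pi^l$, the variable of the block $\pi^l_j$ ranging over $[0,\widehat\tau_{\pi^l_j}]$.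
   Formalization: The intensity on the cell ((l-1)r, lr] is taken to be λ_l with coordinate measured from the right endpoint lr (each λ_l reflected by x ↦ r-x) instead of the left endpoint; with the left-endpoint convention the identity fails for non-symmetric λ_l. *)

(* Defs.v *)
From HB Require Import structures.
From mathcomp Require Import all_boot all_order all_algebra finmap.
From mathcomp Require Import all_classical all_reals all_analysis.

Set Implicit Arguments.
Unset Strict Implicit.
Unset Printing Implicit Defensive.

Import Order.TTheory GRing.Theory Num.Theory.
Import numFieldNormedType.Exports.

Local Open Scope classical_set_scope.
Local Open Scope ring_scope.

(** Number of points of a finite set (0, by convention, on infinite sets). *)
Definition npoints (T : choiceType) (A : set T) : nat := #|` fset_set A|.

(** Intensity of the nodes: on the cell ](l - 1) r, l r] it is [lam l], read in
    the coordinate x of the point (l - 1) r + x. *)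
Definition intensity (R : realType) (k : nat) (r : R)
    (lam : nat -> set R -> \bar R) : set R -> \bar R :=
  fun A => (\sum_(1 <= l < k.+1)
    let left := (l.-1%:R * r)%R in
    let right := (l%:R * r)%R in
    lam l [set x | `]left, right]%classic (left + x)%R /\ A (left + x)%R])%E.

(** Poisson point process on the line with finite intensity measure [mu], as a
    random finite set. [poisson_prob] has a dummy [nat] argument; it is used
    rather than [poisson_pmf] because the latter is not a mass function at
    rate 0. *)
Record poisson_process (R : realType) (d : measure_display)
    (T : measurableType d) (P : probability T R) (mu : set R -> \bar R)
    (eta : T -> set R) : Prop := PoissonProcess {
  pp_finite : forall w, finite_set (eta w) ;
  pp_measurable : forall B : set R, measurable B ->
    measurable_fun [set: T] (fun w => npoints (eta w `&` B)) ;
  pp_law : forall (B : set R) (U : set nat), measurable B ->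
    P [set w | U (npoints (eta w `&` B))] = poisson_prob (fine (mu B)) 0 U ;
  pp_indep : forall (m : nat) (B : 'I_m -> set R) (U : 'I_m -> set nat),
    (forall i, measurable (B i)) -> trivIset [set: 'I_m] B ->
    P [set w | forall i, U i (npoints (eta w `&` B i))] =
    (\prod_(i < m) P [set w | U i (npoints (eta w `&` B i))])%E }.

Definition connected_nodes (R : realType) (r : R) : rel R :=
  fun s t => `|t - s| <= r.

(** A k-hop from 0 to [t] is given by the sequence of its k - 1 intermediate
    nodes, which are distinct. *)
Definition khops (R : realType) (k : nat) (r : R) (nodes : set R) (t : R) :
    set (seq R) :=
  [set s | [/\ size s = k.-1, uniq s, [set` s] `<=` nodes &
              path (connected_nodes r) 0 (rcons s t)]].

Definition sigma_khop (R : realType) (k : nat) (r : R) (nodes : set R)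
    (t : R) : nat :=
  npoints (khops k r nodes t).

(** Product of the measures [mu i], i ranging over the duplicate-free sequence
    [s], on the space X^s encoded as ((unit * X) * ... ) * X; [iprod_coord z i] is
    the coordinate of index i. *)
Fixpoint iprod_display (d : measure_display) (I : Type) (s : seq I) :
    measure_display :=
  if s is _ :: s' then measure_prod_display (iprod_display d s', d)
  else default_measure_display.

Fixpoint iprod (d : measure_display) (X : measurableType d) (I : Type)
    (s : seq I) : measurableType (iprod_display d s) :=
  match s with
  | [::] => unit
  | _ :: s' => (iprod X s' * X)%type
  end.

Fixpoint iprod_measure (R : realType) (d : measure_display)
    (X : measurableType d) (I : Type)
    (mu : I -> {finite_measure set X -> \bar R}) (s : seq I) :
    {measure set (iprod X s) -> \bar R} :=
  match s return {measure set (iprod X s) -> \bar R} with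
  | [::] => \d_tt
  | i :: s' => (iprod_measure mu s' \x mu i)%E
  end.

Fixpoint iprod_coord (d : measure_display) (X : measurableType d) (I : eqType)
    (s : seq I) : iprod X s -> I -> X :=
  match s return iprod X s -> I -> X with
  | [::] => fun _ _ => point
  | i :: s' => fun z j => if j == i then z.2 else iprod_coord z.1 j
  end.

(** The families (pi^1, ..., pi^(k-1)) of partitions of an n-element set;
    [p l] stands for pi^(l+1), as ordinals start from 0. *)
Definition partition_families (k n : nat) :
    {set {ffun 'I_k.-1 -> {set {set 'I_n}}}} :=
  [set p : {ffun 'I_k.-1 -> {set {set 'I_n}}} |
    [forall l, finset.partition (p l) [set: 'I_n]%SET]]%SET.

(** The blocks of a family of partitions, each with its level. *)
Definition blocks (k n : nat) (p : {ffun 'I_k.-1 -> {set {set 'I_n}}}) :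
    seq ('I_k.-1 * {set 'I_n}) :=
  enum [set x : 'I_k.-1 * {set 'I_n} | x.2 \in p x.1]%SET.

(** Minimum of the [tau i], i in b, for a nonempty b and [tau] bounded by [r]. *)
Definition tau_hat (R : realType) (n : nat) (r : R) (tau : 'I_n -> R)
    (b : {set 'I_n}) : R :=
  \big[Num.min/r]_(i in b) tau i.

(* Main.v *)
(** Discretize the line by grids indexed by N. At level N, the number of
    families of nodes whose distinct points lie in distinct grid intervals and
    whose intervals are in a prescribed strict order is a finite sum of
    products of counts of disjoint sets, so by independence its mean is the
    same sum of products of intensities, that is, the integral of a
    discretized indicator. Both sides increase with N, and monotone convergence
    yields the factorial moment formula.

    A k-hop to k r - tau has exactly one intermediate node in each of the first
    k - 1 cells, at distances z^1 <= ... <= z^(k-1) <= tau from the right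
    endpoints; ties and nodes at multiples of r have probability zero because
    the intensities are atomless. The product of the hop counts thus counts
    n x (k - 1) arrays of nodes, and sorting these arrays by the partitions
    pi^l recording which rows share their l-th node reduces each term of the
    sum to a factorial moment. *)

Require Import Defs.
From mathcomp Require Import all_boot all_order all_algebra finmap.
From mathcomp Require Import all_classical all_reals all_analysis.
From mathcomp Require Import measurable_realfun ring lra.

Set Implicit Arguments.
Unset Strict Implicit.
Unset Printing Implicit Defensive.

Import Order.TTheory GRing.Theory Num.Theory.
Import numFieldNormedType.Exports.

Local Open Scope classical_set_scope.
Local Open Scope ring_scope.

(** * Integrals of nonnegative functions, up to null sets *)

Lemma ge0_le_integralT d (T : measurableType d) (R : realType)
    (mu : {measure set T -> \bar R}) (f g : T -> \bar R) :
  (forall x, 0 <= f x)%E -> (forall x, f x <= g x)%E ->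
  (\int[mu]_x f x <= \int[mu]_x g x)%E.
Proof.
move=> f0 fg; rewrite !ge0_integralTE //; last first.
  by move=> x; apply: le_trans (fg x).
(* As a supremum over the simple functions below, the integral is monotone even for functions not
   known to be measurable. *)
apply: le_ereal_sup => _ [h /= hf <-]; exists h => // x.
exact: le_trans (hf x) (fg x).
Qed.

(** Only [g] is known to be measurable. The function [f] is squeezed between [g] cut to 0 on [N] and
    [g] raised to +oo on [N], which have the same integral. In the end [f] is the product of the hop
    counts. *)
Lemma ge0_eq_integral_null d (T : measurableType d) (R : realType)
    (mu : {measure set T -> \bar R}) (N : set T) (f g : T -> \bar R) :
  measurable N -> mu N = 0%E -> measurable_fun [set: T] g ->
  (forall x, 0 <= f x)%E -> (forall x, 0 <= g x)%E ->
  (forall x, ~ N x -> f x = g x) ->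
  (\int[mu]_x f x = \int[mu]_x g x)%E.
Proof.
move=> mN N0 mg f0 g0 fg.
have mNC : measurable (~` N) by exact: measurableC.
have gE : (\int[mu]_x g x = \int[mu]_x (g \_ (~` N)) x)%E.
  by rewrite (@ge0_negligible_integral _ _ _ mu setT N) // setTD integral_mkcond.
have leN : (\int[mu]_x (g \_ (~` N)) x <= \int[mu]_x f x)%E.
  apply: ge0_le_integralT => x; first exact: erestrict_ge0.
  rewrite /patch; case: ifPn => [|_]; last exact: f0.
  by rewrite inE => /fg ->.
pose h x : \bar R := (if x \in N then +oo else g x)%E.
have mh : measurable_fun setT h.
  apply: measurable_fun_if => //.
  - apply: (measurable_fun_bool true); rewrite setTI (_ : _ @^-1` _ = N) //.
    by apply/seteqP; split => x /=; [exact: set_mem|move/mem_set].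
  - exact: measurable_funTS.
have h0 x : (0 <= h x)%E by rewrite /h; case: ifP.
have hE : (\int[mu]_x h x = \int[mu]_x (g \_ (~` N)) x)%E.
  rewrite (@ge0_negligible_integral _ _ _ mu setT N) // setTD integral_mkcond.
  apply: eq_integral => x _; rewrite /patch; case: ifPn => //; rewrite inE => Nx.
  by rewrite /h memNset.
apply/eqP; rewrite eq_le gE leN andbT -hE.
apply: ge0_le_integralT => // x; rewrite /h; case: ifPn => [_|/negP Nx].
  exact: leey.
by rewrite fg // => /mem_set.
Qed.

(** * Means of products of independent counts *)

Lemma nat_nneseries (R : realType) (n : nat) :
  (n%:R%:E = \sum_(u <oo) (u%:R * \1_[set u] n)%:E :> \bar R)%E.
Proof.
rewrite (@nneseriesD1 _ _ n xpredT) //.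
rewrite indicE mem_set // mulr1 eseries0 ?adde0 // => u _ /= un.
by rewrite indicE memNset ?mulr0 // => nu; rewrite nu eqxx in un.
Qed.

Lemma measurable_nat_comp d (T : measurableType d) (R : realType)
    (N : T -> nat) (f : nat -> R) :
  measurable_fun [set: T] N -> measurable_fun [set: T] (fun w => f (N w)).
Proof. by move=> mN; apply: (measurableT_comp _ mN). Qed.

Section independent_counts.
Context (R : realType) d (T : measurableType d) (P : probability T R) (m : nat).
Variable N : 'I_m -> T -> nat.
Hypothesis mN : forall i, measurable_fun [set: T] (N i).
Hypothesis N_indep : forall U : 'I_m -> set nat,
  P [set w | forall i, U i (N i w)] = (\prod_(i < m) P [set w | U i (N i w)])%E.
Let mean i := (\int[P]_w (N i w)%:R%:E)%E.
Hypothesis mean_fin : forall i, mean i \is a fin_num.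

(* Replace the indicators by counts one index at a time, expanding
   N_j = sum_u u 1_(N_j = u). *)
Lemma independent_counts_partial (j : nat) (U : 'I_m -> set nat) : (j <= m)%N ->
  (\int[P]_w (\prod_(i < m)
     if (i < j)%N then (N i w)%:R else \1_(U i) (N i w))%:E =
   \prod_(i < m) if (i < j)%N then mean i else P [set w | U i (N i w)])%E.
Proof.
elim: j U => [|j IH] U jm.
  rewrite -N_indep; transitivity (\int[P]_w
      (\1_[set w | forall i, U i (N i w)] w)%:E)%E.
    apply: eq_integral => w _; congr EFin; rewrite indicE.
    have [UN|UN] := pselect (forall i, U i (N i w)).
      rewrite mem_set // big1 // => i _.
      by rewrite /= indicE mem_set //; exact: UN.
    have [i Ui] := (existsNP _).2 UN.
    by rewrite (bigD1 i) //= indicE memNset // mul0r memNset.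
  rewrite integral_indic ?setIT //.
  rewrite (_ : [set w | _] = \bigcap_(i in [set: 'I_m]) (N i @^-1` U i)).
    apply: fin_bigcap_measurable => // i _.
    by rewrite -[X in measurable X]setTI; exact: mN.
  by apply/seteqP; split => w /= UN i; [move=> _|]; apply: UN.
pose i0 := Ordinal jm.
(* The induction hypothesis is applied with the event N_j = u imposed at the index j that is about
   to become a count. *)
pose U' u i := if i == i0 then [set u] else U i.
have fE u w : \prod_(i < m) (if (i < j)%N then (N i w)%:R
     else \1_(U' u i) (N i w)) = \1_[set u] (N i0 w) *
     \prod_(i < m | i != i0) (if (i < j.+1)%N then (N i w)%:R
     else \1_(U i) (N i w)) :> R.
  rewrite (bigD1 i0) //= ltnn /U' eqxx; congr (_ * _).
  apply: eq_bigr => i ii0; rewrite (negbTE ii0) ltnS [(i <= j)%N]leq_eqVlt.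
  by rewrite (_ : (i == j :> nat) = false) //; apply/negbTE.
have PE u : (\prod_(i < m) (if (i < j)%N then mean i
     else P [set w | U' u i (N i w)]) = P [set w | N i0 w = u] *
     \prod_(i < m | i != i0) (if (i < j.+1)%N then mean i
     else P [set w | U i (N i w)]))%E.
  rewrite (bigD1 i0) //= ltnn /U' eqxx; congr (_ * _)%E.
  apply: eq_bigr => i ii0; rewrite (negbTE ii0) ltnS [(i <= j)%N]leq_eqVlt.
  by rewrite (_ : (i == j :> nat) = false) //; apply/negbTE.
set C := (\prod_(i < m | i != i0) _)%E in PE.
have Cfin : C \is a fin_num.
  apply: prode_fin_num => i _; case: ifP => // _; apply: fin_num_measure.
  rewrite (_ : [set w | _] = N i @^-1` U i) // -[X in measurable X]setTI.
  exact: mN.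
rewrite [RHS](bigD1 i0) //= ltnSn -/C.
have mterm k V (i : 'I_m) : measurable_fun [set: T] (fun w =>
    if (i < k)%N then (N i w)%:R else \1_(V i) (N i w) : R).
  by case: (i < k)%N; [exact: (measurable_nat_comp (fun n => n%:R))
    | exact: measurable_nat_comp].
have -> : mean i0 = (\sum_(u <oo) u%:R%:E * P [set w | N i0 w = u])%E.
  rewrite /mean; under eq_integral do rewrite nat_nneseries.
  rewrite integral_nneseries //; last first.
    by move=> u; apply/measurable_EFinP; apply: measurable_funM => //;
      exact: measurable_nat_comp.
  apply: eq_eseriesr => u _; under eq_integral do rewrite EFinM.
  rewrite ge0_integralZl_EFin //; last first.
    by apply/measurable_EFinP; exact: measurable_nat_comp.
  congr (_ * _)%E; transitivity (P ([set w | N i0 w = u] `&` setT)).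
    2: by rewrite setIT.
  rewrite -integral_indic //.
  rewrite (_ : [set w | _] = N i0 @^-1` [set u]) //.
  by rewrite -[X in measurable X]setTI; exact: mN.
rewrite -(fineK Cfin) muleC -nneseriesZl; last first.
  by move=> u _; rewrite mule_ge0.
rewrite fineK //.
transitivity (\sum_(u <oo) u%:R%:E * \int[P]_w (\prod_(i < m)
     if (i < j)%N then (N i w)%:R else \1_(U' u i) (N i w))%:E)%E; last first.
  apply: eq_eseriesr => u _; rewrite IH ?(ltnW jm) // PE.
  by rewrite muleA muleC.
under [RHS]eq_eseriesr => u _.
  rewrite -ge0_integralZl_EFin //; [|by move=> w _; rewrite lee_fin prodr_ge0 // => i _; case: ifP|
   by apply/measurable_EFinP; apply: measurable_prod => i _; exact: mterm].
  over.
rewrite -integral_nneseries //; first last.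
- by move=> u w _; rewrite mule_ge0 // lee_fin prodr_ge0 // => i _; case: ifP.
- move=> u; apply/measurable_EFinP; apply: measurable_funM => //.
  by apply: measurable_prod => i _; exact: mterm.
apply: eq_integral => w _; rewrite (bigD1 i0) //= ltnSn EFinM nat_nneseries.
rewrite muleC -nneseriesZl //.
apply: eq_eseriesr => u _; rewrite fE -!EFinM; congr EFin.
by rewrite mulrC mulrA.
Qed.

Lemma independent_counts_mean_prod :
  (\int[P]_w (\prod_(i < m) (N i w)%:R)%:E = \prod_(i < m) mean i)%E.
Proof.
have := independent_counts_partial (fun=> setT) (leqnn m).
under eq_integral do under eq_bigr do rewrite ltn_ord.
by under [in RHS]eq_bigr do rewrite ltn_ord.
Qed.

End independent_counts.

(** The identity (u + 1) p(u + 1) = x p(u) shifts the series of the mean into x times the total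
    mass. At rate 0, [poisson_prob] is the Dirac mass at 0 and every term vanishes. *)
Lemma poisson_count_mean (R : realType) d (T : measurableType d)
    (P : probability T R) (N : T -> nat) (x : R) : 0 <= x ->
  measurable_fun [set: T] N ->
  (forall U : set nat, P [set w | U (N w)] = poisson_prob x 0 U) ->
  (\int[P]_w (N w)%:R%:E = x%:E)%E.
Proof.
move=> x0 mN law.
under eq_integral do rewrite nat_nneseries.
rewrite integral_nneseries //; last first.
  by move=> u; apply/measurable_EFinP; apply: measurable_funM => //;
    exact: measurable_nat_comp.
transitivity (\sum_(u <oo) u%:R%:E * poisson_prob x 0 [set u])%E.
  apply: eq_eseriesr => u _; under eq_integral do rewrite EFinM.
  rewrite ge0_integralZl_EFin //; last first.
    by apply/measurable_EFinP; exact: measurable_nat_comp.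
  congr (_ * _)%E; rewrite -law.
  transitivity (P ([set w | [set u] (N w)] `&` setT)).
    2: by rewrite setIT.
  rewrite -integral_indic //.
  rewrite (_ : [set w | _] = N @^-1` [set u]) //.
  by rewrite -[X in measurable X]setTI; exact: mN.
have [xp|] := boolP (0 < x); last first.
  rewrite lt0r x0 andbT negbK => /eqP ->.
  apply: eseries0 => u _ _; rewrite /poisson_prob ltxx diracE.
  case: (ltnP 0 u) => u0; last by move: u0; rewrite leqn0 => /eqP ->; rewrite mul0e.
  by rewrite memNset ?mule0 //= => u0'; rewrite -u0' in u0.
have pE u : poisson_prob x 0 [set u] = (poisson_pmf x u)%:E.
  rewrite /poisson_prob xp esum_set1 // lee_fin; exact: poisson_pmf_ge0.
have pS u : u.+1%:R * poisson_pmf x u.+1 = x * poisson_pmf x u.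
  rewrite /poisson_pmf xp exprS factS natrM invfM.
  have := pnatr_eq0 R u.+1 => /= /negbT.
  move: (u.+1%:R : R) (u`!%:R^-1 : R) => a f a0.
  by field.
have pge0 u : (0 <= (poisson_pmf x u)%:E)%E by rewrite lee_fin poisson_pmf_ge0.
have tot : (\sum_(u <oo) (poisson_pmf x u)%:E = 1)%E.
  rewrite nneseries_esumT //; have := law setT.
  rewrite /poisson_prob xp => <-; rewrite (_ : [set w | _] = setT) ?probability_setT //.
rewrite (nneseries_split 0 1); last by move=> u _; rewrite mule_ge0.
rewrite add0n big_nat1 mul0e add0e.
rewrite -[in RHS](mule1 x%:E) -tot -nneseriesZl //.
rewrite -(nneseries_addn 1); last by move=> u; rewrite mule_ge0.
by apply: eq_eseriesr => u _; rewrite addn1 pE -!EFinM pS.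
Qed.

(** * Grids of rational points *)

Section grid.
Context (R : realType).

(* The rational numbers in the order of their codes, and 0 at invalid codes. *)
Definition grid_point (j : nat) : R := if @choice.unpickle rat j is Some q then ratr q else 0.

(** Index of the interval containing x among those cut out by the first N grid points. It is
    monotone in x, so a strict inequality of indices certifies a strict inequality of points. *)
Definition grid (N : nat) (x : R) : nat := (\sum_(j < N) (grid_point j <= x)%R)%N.

Lemma grid_leq N x : (grid N x <= N)%N.
Proof.
rewrite /grid -[leqRHS]card_ord -sum1_card.
by apply: leq_sum => j _; case: (_ <= _).
Qed.

Lemma grid_homo N x y : x <= y -> (grid N x <= grid N y)%N.
Proof.
move=> xy; apply: leq_sum => j _; case: (leP (grid_point j) x) => // jx.
by rewrite (le_trans jx xy).
Qed.

Lemma grid_ltW N x y : (grid N x < grid N y)%N -> x < y.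
Proof. by rewrite !ltNge => /negP h; apply/negP => /(grid_homo N); rewrite leqNgt => /negP. Qed.

(** Once x < y, a new grid point at or below x is also at or below y, so refinement never closes a
    gap between indices. This makes the discretizations increase with the grid level. *)
Lemma grid_lt_leq N M x y : (N <= M)%N ->
  (grid N x < grid N y)%N -> (grid M x < grid M y)%N.
Proof.
move=> /subnK <-; elim: (M - N)%N => // m IH /IH h.
rewrite addSn /grid !big_ord_recr /= -!/(grid _ _).
rewrite -addSn; apply: leq_add => //; case: (leP (grid_point _) x) => // jx.
by rewrite (le_trans jx) // ltW // (grid_ltW h).
Qed.

Lemma grid_lt_ex x y : x < y -> exists N, (grid N x < grid N y)%N.
Proof.
move=> xy; have [q] := rat_in_itvoo xy; rewrite in_itv /= => /andP[xq qy].
(* With this N the last grid point is q, which is counted for y and not for x. *)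
exists (choice.pickle q).+1; rewrite /grid !big_ord_recr /= /grid_point !choice.pickleK.
rewrite (ltW qy) leNgt xq /= addn0 addn1 ltnS.
exact: (grid_homo _ (ltW xy)).
Qed.

Lemma grid_lt_near (I : finType) (c : I -> R) : exists N0, forall N, (N0 <= N)%N ->
  forall b b', (grid N (c b) < grid N (c b'))%N = (c b < c b').
Proof.
have /choice[f fP] (u : I * I) : exists n, forall N, (n <= N)%N ->
    (grid N (c u.1) < grid N (c u.2))%N = (c u.1 < c u.2).
  have [cu|cu] := boolP (c u.1 < c u.2).
    have [n nP] := grid_lt_ex cu; exists n => N /grid_lt_leq; exact.
  exists 0%N => N _; apply/negbTE; apply: contra cu; exact: grid_ltW.
exists (\max_u f u)%N => N fN b b'; apply: (fP (b, b')).
exact: leq_trans (leq_bigmax _) fN.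
Qed.

Lemma measurable_grid N a : measurable [set x | grid N x = a].
Proof.
apply: is_interval_measurable => x y /= xa ya z /andP[xz zy].
by apply/eqP; rewrite eqn_leq -{1}ya -xa !grid_homo.
Qed.

End grid.

(** * Finite product measures: boxes and diagonals *)

Section iprod.
Context (R : realType) d (X : measurableType d) (I : choiceType).
Variable mu : I -> {finite_measure set X -> \bar R}.

Lemma measurable_iprod_coord (s : seq I) b :
  measurable_fun [set: iprod X s] (fun z => iprod_coord z b).
Proof.
elim: s => [|i s IH] /=; first exact: measurable_cst.
case: (b == i); first exact: measurable_snd.
exact: (measurableT_comp IH measurable_fst).
Qed.

Lemma measurable_iprod_box (s : seq I) (B : I -> set X) :
  (forall b, measurable (B b)) ->
  measurable [set z : iprod X s | forall b, b \in s -> B b (iprod_coord z b)].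
Proof.
move=> mB; rewrite (_ : [set z | _] =
    \big[setI/setT]_(b <- s) ((fun z : iprod X s => iprod_coord z b) @^-1` B b)).
  apply: big_ind => //; first exact: measurableI.
  move=> b _; rewrite -[X in measurable X]setTI.
  by apply: measurable_iprod_coord.
rewrite -bigcap_seq; apply/seteqP; split => z /= h b; exact: h.
Qed.

Lemma iprod_measure_box (s : seq I) (B : I -> set X) : uniq s ->
  (forall b, measurable (B b)) ->
  (iprod_measure mu s [set z | forall b, b \in s -> B b (iprod_coord z b)] =
   \prod_(b <- s) mu b (B b))%E.
Proof.
move=> us mB; elim: s us => [_|i s IH /= /andP[iNs us]].
  by rewrite big_nil /= diracE mem_set.
rewrite big_cons -IH // muleC -product_measure1E //; last exact: measurable_iprod_box.
congr (product_measure1 _ _ _); apply/seteqP; split => -[z x] /= h.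
  split => [b bs|].
    have := h b; rewrite inE bs orbT => /(_ isT).
    by case: eqP => // bi; rewrite -bi bs in iNs.
  by have := h i (mem_head _ _); rewrite eqxx.
by move=> b; rewrite inE; case: eqP => [-> _|_ /= bs]; [exact: h.2|exact: h.1].
Qed.

End iprod.

Lemma measurable_iprod_diag (R : realType) (I : choiceType) (s : seq I) b b' :
  measurable [set z : iprod R s | iprod_coord z b = iprod_coord z b'].
Proof.
have meq := measurable_fun_eqr (@measurable_iprod_coord _ R I s b)
  (@measurable_iprod_coord _ R I s b').
have := meq measurableT [set true] Logic.I; rewrite setTI.
by congr (measurable _); apply/seteqP; split => z /= /eqP.
Qed.

(** By induction on [s]: if one of the two indices is the head, every section of the diagonal is a
    singleton, hence null; otherwise the diagonal is a cylinder over the diagonal of the tail. *)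
Lemma iprod_measure_diag (R : realType) (I : choiceType)
    (mu : I -> {finite_measure set R -> \bar R}) (s : seq I) b b' :
  uniq s -> b \in s -> b' \in s -> b != b' ->
  (forall i x, i \in s -> mu i [set x] = 0%E) ->
  iprod_measure mu s [set z | iprod_coord z b = iprod_coord z b'] = 0%E.
Proof.
elim: s => // i s IH /= /andP[iNs us]; rewrite !inE => bs bs' bb' mu0.
have [bi|bi] := eqVneq b i; have [bi'|bi'] := eqVneq b' i.
- by rewrite bi bi' eqxx in bb'.
- apply: integral0_eq => z _ /=; rewrite -[RHS](mu0 i (iprod_coord z b')) ?mem_head //.
  congr (mu i _); apply/seteqP; split => x /=;
    [by move/xsectionP => /= ->|by move=> ->; apply/xsectionP].
- apply: integral0_eq => z _ /=; rewrite -[RHS](mu0 i (iprod_coord z b)) ?mem_head //.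
  congr (mu i _); apply/seteqP; split => x /=;
    [by move/xsectionP => /= ->|by move=> ->; apply/xsectionP].
rewrite (negbTE bi) (negbTE bi') /= in bs bs'.
rewrite (_ : [set z | _] = [set z | iprod_coord z b = iprod_coord z b'] `*` setT).
  rewrite product_measure1E //.
    by rewrite IH ?mul0e // => j x js; apply: mu0; rewrite inE js orbT.
  exact: measurable_iprod_diag.
by apply/seteqP; split => -[z x] /=; tauto.
Qed.

(** * Cells and distances to their right endpoints *)

Section cells.
Context (R : realType) (r : R).
Hypothesis r0 : 0 < r.

(* Cells are numbered from 0: cell [l] is ]l r, (l + 1) r]. *)
Definition cell_dist (l : nat) (s : R) : R := l.+1%:R * r - s.

(** The set [A] is read in the distance to the right endpoint of the cell, the coordinate used by
    the integration variables. *)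
Definition cell (l : nat) (A : set R) : set R :=
  [set s | 0 <= cell_dist l s < r /\ A (cell_dist l s)].

Lemma cell_level l l' s : 0 <= cell_dist l s < r -> 0 <= cell_dist l' s < r ->
  l = l'.
Proof.
have H m m' : 0 <= cell_dist m s < r -> 0 <= cell_dist m' s < r -> (m <= m')%N.
  rewrite /cell_dist => /andP[_ h1] /andP[h2 _]; rewrite leqNgt; apply/negP => mm.
  have : m'.+1%:R * r <= m%:R * r by rewrite ler_wpM2r ?(ltW r0) // ler_nat.
  by move: h1 h2; rewrite -[m.+1%:R]natr1; lra.
by move=> h h'; apply/eqP; rewrite eqn_leq !H.
Qed.

Lemma measurable_cell l (A : set R) : measurable A -> measurable (cell l A).
Proof.
move=> mA; have mz : measurable_fun [set: R] (cell_dist l).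
  by apply: measurable_funB => //; exact: measurable_id.
have -> : cell l A = cell_dist l @^-1` (`[0, r[ `&` A).
  by apply/seteqP; split => s; rewrite /cell /= in_itv.
rewrite -[X in measurable X]setTI; apply: mz => //; exact: measurableI.
Qed.

Lemma trivIset_cell l l' A A' : (l = l' -> A `&` A' = set0) ->
  cell l A `&` cell l' A' = set0.
Proof.
move=> AA'; apply/seteqP; split => s //= -[[h As] [h' A's]].
have ll := cell_level h h'; rewrite -ll in A's.
have : (A `&` A') (cell_dist l s) by [].
by rewrite AA'.
Qed.

(** The reflection x |-> r - x in the pushforward cancels the passage from left to right endpoints.
    Only one summand meets the cell; its index is [l.+1] because [intensity] numbers the cells from
    1. *)
Lemma intensity_cell k (lam : nat -> {finite_measure set R -> \bar R}) l A :
  (l < k)%N ->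
  intensity k r (fun l => pushforward (lam l) (fun x => r - x)) (cell l A) =
  lam l.+1 (A `&` `[0, r[).
Proof.
move=> lk; rewrite /intensity (bigD1_seq l.+1) ?iota_uniq //=; last first.
  by rewrite mem_index_iota /= ltnS.
rewrite big1_seq ?adde0.
  congr (lam l.+1 _); apply/seteqP; split => x /=.
    case=> _ [+ +]; have -> : cell_dist l (l%:R * r + (r - x)) = x.
      by rewrite /cell_dist -natr1; ring.
    by move=> h Ax; split => //; rewrite in_itv.
  rewrite in_itv /= => -[Ax h].
  have E : cell_dist l (l%:R * r + (r - x)) = x by rewrite /cell_dist -natr1; ring.
  split; last by rewrite /cell /= E.
  by rewrite in_itv /= -[l.+1%:R]natr1; move: h; lra.
move=> l' /andP[ll']; rewrite mem_index_iota => /andP[l'0 _].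
case: l' l'0 ll' => // l' _; rewrite eqSS => /= /eqP ll'.
rewrite /pushforward (_ : _ @^-1` _ = set0) ?measure0 //; apply/seteqP; split => x //=.
rewrite in_itv /= => -[h [h' _]]; apply: ll'; apply: cell_level h'.
by move: h; rewrite /cell_dist -[l'.+1%:R]natr1; lra.
Qed.

End cells.

(** * Counts of nodes in subsets of cells *)

Section counts.
Context (R : realType) (k : nat) (r : R).
Hypothesis r0 : 0 < r.
Variable lam : nat -> {finite_measure set R -> \bar R}.
Context d (Omega : measurableType d) (P : probability Omega R)
  (eta : Omega -> set R).
Hypothesis heta : poisson_process P
    (intensity k r (fun l => pushforward (lam l) (fun x => r - x))) eta.

Definition cell_count (l : nat) (A : set R) (w : Omega) : nat :=
  npoints (eta w `&` cell r l A).

Lemma measurable_cell_count l A : measurable A ->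
  measurable_fun [set: Omega] (fun w => (cell_count l A w)%:R : R).
Proof.
move=> mA; apply: (measurable_nat_comp (fun n => n%:R)).
by apply: (pp_measurable heta); exact: measurable_cell.
Qed.

(** The counted sets are disjoint: at different levels because the cells are, at equal levels by
    hypothesis. Their counts are therefore independent Poisson variables, with means given by
    [intensity_cell]. *)
Lemma cell_count_mean_prod (I : finType) (D : {set I}) (lev : I -> nat)
    (A : I -> set R) :
  (forall b, b \in D -> (lev b < k)%N) ->
  (forall b, measurable (A b)) ->
  {in D &, forall b b', b != b' -> lev b = lev b' -> A b `&` A b' = set0} ->
  (\int[P]_w (\prod_(b in D) (cell_count (lev b) (A b) w)%:R)%:E =
   \prod_(b in D) lam (lev b).+1 (A b `&` `[0%R, r[%classic))%E.
Proof.
move=> levk mA dis.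
have mcell i := measurable_cell r (lev i) (mA i).
have fin b : lam (lev b).+1 (A b `&` `[0, r[%classic) \is a fin_num.
  by apply: fin_num_measure; exact: measurableI.
have mean b : b \in D -> (\int[P]_w (cell_count (lev b) (A b) w)%:R%:E =
    lam (lev b).+1 (A b `&` `[0%R, r[%classic))%E.
  move=> bD; rewrite -(fineK (fin b)); apply: poisson_count_mean.
  - exact: fine_ge0.
  - by apply: (pp_measurable heta); exact: mcell.
  - move=> U; have := pp_law heta U (mcell b).
    by rewrite intensity_cell // levk.
rewrite big_enum_val /=; under eq_integral do rewrite big_enum_val /=.
rewrite independent_counts_mean_prod.
- by apply: eq_bigr => i _; rewrite mean ?enum_valP.
- by move=> i; apply: (pp_measurable heta); exact: mcell.
- move=> U; apply: (pp_indep heta (B := fun i => cell r (lev (enum_val i)) (A (enum_val i)))).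
    by move=> i; exact: mcell.
  apply/trivIsetP => i j _ _ ij; apply: (trivIset_cell r0) => ll.
  by apply: dis; rewrite ?enum_valP // (inj_eq enum_val_inj).
- by move=> i; rewrite mean ?enum_valP.
Qed.

End counts.

Lemma npoints_image (T : finType) (U : choiceType) (p : pred T) (f : T -> U)
    (A : set U) : {in p &, injective f} -> (forall x, A x <-> exists2 t, p t & f t = x) ->
  npoints A = #|p|.
Proof.
move=> finj Af; pose s := [seq f t | t <- enum p].
have us : uniq s.
  by rewrite map_inj_in_uniq ?enum_uniq // => t u; rewrite !mem_enum; exact: finj.
have As : A = [set` s].
  apply/seteqP; split => x /=.
    by move=> /Af[t pt <-]; apply: map_f; rewrite mem_enum.
  by move=> /mapP[t]; rewrite mem_enum => pt ->; apply/Af; exists t.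
have -> : npoints A = #|` [fset x in s]%fset|.
  rewrite /npoints; congr (size (enum_fset _)); apply/fsetP => x.
  rewrite in_fset_set; last by rewrite As; exact: finite_seq.
  by rewrite !inE As; apply/idP/idP => [/set_mem|/mem_set].
by rewrite card_fseq undup_id // size_map -cardE.
Qed.

(** * Indexing of the nodes by ordinals *)

Section node.
Context (R : realType) (E : set R).

(* The point -1 lies in no cell: it makes the enumeration nonempty. *)
Definition node_seq : seq R := -1 :: [seq x <- fset_set E | x != -1].

Definition node (t : 'I_(size node_seq)) : R := nth 0 node_seq t.

Lemma node_inj : injective node.
Proof.
have u : uniq node_seq.
  by rewrite /= mem_filter eqxx /= filter_uniq ?fset_uniq.
by move=> t t' /eqP; rewrite nth_uniq // => /eqP/val_inj.
Qed.

Lemma node_surj x : finite_set E -> E x -> exists t, node t = x.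
Proof.
move=> fE Ex; have xs : x \in node_seq.
  rewrite inE; case: eqP => //= x1; rewrite mem_filter in_fset_set // mem_set // andbT.
  exact/eqP.
have lt : (index x node_seq < size node_seq)%N by rewrite index_mem.
by exists (Ordinal lt); rewrite /node nth_index.
Qed.

End node.

(** * Discretized indicators of boxes with an order condition *)

Section discretization.
Context (R : realType) (I : finType) (D : {set I}).
Variables (B : I -> set R) (Q : rel I -> bool).
Hypothesis Q_local : forall e e' : rel I,
  {in D &, forall b b', e b b' = e' b b'} -> Q e = Q e'.
Hypothesis Q_mono : forall e e' : rel I,
  (forall b b', e b b' -> e' b b') -> Q e -> Q e'.

Definition lt_rel (c : I -> R) : rel I := fun b b' => c b < c b'.
Definition grid_rel (N : nat) (c : I -> R) : rel I :=
  fun b b' => (grid N (c b) < grid N (c b'))%N.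
Definition idx_rel (N : nat) (q : {ffun I -> 'I_N}) : rel I :=
  fun b b' => (q b < q b')%N.

(** The order condition [Q] is imposed through a relation [e], which is either the true order of the
    coordinates or its grid approximation. Monotonicity of [Q] makes the indicator increase as the
    grid is refined. *)
Definition box_ind (e : rel I) (c : I -> R) : R :=
  (\prod_(b in D) \1_(B b) (c b)) * (Q e)%:R.

(** Values outside [D] are pinned, so that each choice of grid intervals on [D] occurs once. *)
Definition idx_normal N (q : {ffun I -> 'I_N.+1}) :=
  [forall b, (b \notin D) ==> (q b == ord0)].

Lemma box_ind_ge0 e c : 0 <= box_ind e c.
Proof. by rewrite mulr_ge0 // prodr_ge0. Qed.

Lemma box_ind_mono (e e' : rel I) c : (forall b b', e b b' -> e' b b') ->
  box_ind e c <= box_ind e' c.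
Proof.
move=> ee'; rewrite /box_ind ler_wpM2l ?prodr_ge0 //.
by rewrite ler_nat; case: (Q e) (Q_mono ee') => // ->.
Qed.

Lemma box_ind_grid_homo N M c : (N <= M)%N ->
  box_ind (grid_rel N c) c <= box_ind (grid_rel M c) c.
Proof. by move=> NM; apply: box_ind_mono => b b'; exact: grid_lt_leq. Qed.

Lemma box_ind_grid_near c : exists N0, forall N, (N0 <= N)%N ->
  box_ind (grid_rel N c) c = box_ind (lt_rel c) c.
Proof.
have [N0 h] := grid_lt_near c; exists N0 => N N0N; rewrite /box_ind.
by congr (_ * (nat_of_bool _)%:R); apply: Q_local => b b' _ _; exact: h.
Qed.

(** Only the index function [q0] that records the grid intervals of [c] on [D] gives a nonzero term.
    In this form the order condition is a constant coefficient and what depends on [c] is a product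
    over coordinates, which can be integrated factor by factor. *)
Lemma box_ind_gridE N c : box_ind (grid_rel N c) c =
  \sum_(q : {ffun I -> 'I_N.+1} | idx_normal q) (Q (idx_rel q))%:R *
     \prod_(b in D) \1_(B b `&` [set x | grid N x = q b]) (c b).
Proof.
pose q0 : {ffun I -> 'I_N.+1} :=
  [ffun b => if b \in D then inord (grid N (c b)) else ord0].
have q0E b : b \in D -> q0 b = grid N (c b) :> nat.
  by move=> bD; rewrite ffunE bD inordK // ltnS grid_leq.
rewrite (bigD1 q0) /=; last first.
  by apply/forallP => b; apply/implyP => bD; rewrite ffunE (negbTE bD).
rewrite [X in _ + X]big1 ?addr0.
  rewrite /box_ind mulrC; congr (_ * _).
    by congr (nat_of_bool _)%:R; apply: Q_local => b b' bD b'D; rewrite /idx_rel !q0E.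
  apply: eq_bigr => b bD; rewrite !indicE; congr (nat_of_bool _)%:R.
  by apply/idP/idP => /set_mem h; apply/mem_set => //; [split => //=; rewrite q0E|case: h].
move=> q /andP[/forallP qn qq0].
have [b qb] : exists b, q b != q0 b.
  apply/existsP; apply: contraR qq0 => /existsPn h.
  by apply/eqP/ffunP => b; apply/eqP; have := h b; rewrite negbK.
have bD : b \in D.
  by apply: contraR qb => bD; rewrite ffunE (negbTE bD); exact: (implyP (qn b)).
rewrite (bigD1 b) //= indicE memNset ?mul0r ?mulr0 // => -[_ /= h].
by move/negP: qb; apply; apply/eqP/val_inj; rewrite /= q0E.
Qed.

Lemma measurable_slice N b a : measurable (B b) ->
  measurable (B b `&` [set x | grid N x = a]).
Proof. by move=> mB; apply: measurableI => //; exact: measurable_grid. Qed.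

Hypothesis mB : forall b, measurable (B b).

Lemma measurable_box_slice N (q : {ffun I -> 'I_N.+1}) :
  measurable [set z : iprod R (enum D) | forall b, b \in enum D ->
    (B b `&` [set x | grid N x = q b]) (iprod_coord z b)].
Proof.
apply: (@measurable_iprod_box _ R I (enum D)
  (fun b => B b `&` [set x | grid N x = q b])) => b.
exact: measurable_slice.
Qed.

Section integral.
Variable mu : I -> {finite_measure set R -> \bar R}.

Lemma iprod_prod_indic (A : I -> set R) (z : iprod R (enum D)) :
  \prod_(b in D) \1_(A b) (iprod_coord z b) =
  \1_[set z : iprod R (enum D) |
      forall b, b \in enum D -> A b (iprod_coord z b)] z :> R.
Proof.
rewrite [RHS]indicE; have [h|h] := pselect
    (forall b, b \in enum D -> A b (iprod_coord z b)).
  rewrite mem_set // big1 // => b bD; rewrite indicE mem_set //.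
  by apply: h; rewrite mem_enum.
have /existsNP[b /not_implyP[bD Ab]] := h.
rewrite mem_enum in bD.
by rewrite memNset // (bigD1 b) //= indicE memNset ?mul0r.
Qed.

Lemma measurable_box_ind_grid N : measurable_fun [set: iprod R (enum D)]
  (fun z => box_ind (grid_rel N (iprod_coord z)) (iprod_coord z)).
Proof.
under eq_fun do rewrite box_ind_gridE -big_filter.
apply: measurable_sum => q; apply: measurable_funM => //.
under eq_fun do rewrite iprod_prod_indic.
apply: measurable_indic; exact: measurable_box_slice.
Qed.

Lemma integral_box_ind_grid N :
  (\int[iprod_measure mu (enum D)]_z
     (box_ind (grid_rel N (iprod_coord z)) (iprod_coord z))%:E =
   \sum_(q : {ffun I -> 'I_N.+1} | idx_normal q) (Q (idx_rel q))%:R%:E *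
     \prod_(b in D) mu b (B b `&` [set x | grid N x = q b]))%E.
Proof.
under eq_integral do rewrite box_ind_gridE -sumEFin.
rewrite [LHS](_ : _ = \int[iprod_measure mu (enum D)]_z
  \sum_(q <- [seq q <- index_enum {ffun I -> 'I_N.+1} | idx_normal q])
    ((Q (idx_rel q))%:R * \1_[set z : iprod R (enum D) |
      forall b, b \in enum D ->
        (B b `&` [set x | grid N x = q b]) (iprod_coord z b)] z)%:E)%E; last first.
  apply: eq_integral => z _; rewrite big_filter.
  by apply: eq_bigr => q _; rewrite iprod_prod_indic.
rewrite ge0_integral_sum //; last first.
  move=> q; apply/measurable_EFinP; apply: measurable_funM => //.
  by apply: measurable_indic; exact: measurable_box_slice.
rewrite big_filter; apply: eq_bigr => q _.
under eq_integral do rewrite EFinM.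
rewrite ge0_integralZl_EFin //; last first.
  by apply/measurable_EFinP; apply: measurable_indic; exact: measurable_box_slice.
congr (_ * _)%E; rewrite integral_indic ?setIT //; last exact: measurable_box_slice.
rewrite (@iprod_measure_box _ _ R I mu (enum D)
  (fun b => B b `&` [set x | grid N x = q b])) ?enum_uniq //.
  by rewrite big_enum.
by move=> b; exact: measurable_slice.
Qed.

End integral.

End discretization.

(** * Sums over assignments of nodes *)

Section config_sum.
Context (R : realType) (r : R) (I : finType) (D : {set I}) (lev : I -> nat).

Definition node_dist (E : set R) (x : {ffun I -> 'I_(size (node_seq E))}) (b : I) : R :=
  cell_dist r (lev b) (node (x b)).

(** The index functions are pinned to [ord0] outside [D], so that each assignment of points to [D]
    is counted once. The indicators of [E] discard the added point -1 unless it belongs to [E]. *)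
Definition config_sum (E : set R) (f : (I -> R) -> R) : R :=
  \sum_(x in pffun_on (ord0 : 'I_(size (node_seq E))) [in D] predT)
    (\prod_(b in D) \1_E (node (x b))) * f (node_dist x).

Lemma le_config_sum E f g : (forall c, f c <= g c) -> config_sum E f <= config_sum E g.
Proof.
move=> fg; apply: ler_sum => x _; apply: ler_wpM2l => //.
exact: prodr_ge0.
Qed.

Lemma config_sum_ge0 E f : (forall c, 0 <= f c) -> 0 <= config_sum E f.
Proof.
move=> f0; apply: sumr_ge0 => x _; apply: mulr_ge0 => //.
exact: prodr_ge0.
Qed.

Lemma config_sum_near E (f : nat -> (I -> R) -> R) g :
  (forall c, exists N0, forall N, (N0 <= N)%N -> f N c = g c) ->
  exists N0, forall N, (N0 <= N)%N -> config_sum E (f N) = config_sum E g.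
Proof.
move=> /choice[h hP].
exists (\max_(x : {ffun I -> 'I_(size (node_seq E))}) h (node_dist x))%N => N hN.
apply: eq_bigr => x _; congr (_ * _); apply: hP.
exact: leq_trans (leq_bigmax _) hN.
Qed.

Lemma npoints_cell (E : set R) l (A : set R) : finite_set E ->
  A `<=` [set x | 0 <= x < r] ->
  (npoints (E `&` cell r l A))%:R =
  \sum_(t < size (node_seq E)) \1_E (node t) * \1_A (cell_dist r l (node t)) :> R.
Proof.
move=> fE Ar; rewrite (@npoints_image _ _ [pred t |
  (node t \in E) && (cell_dist r l (node t) \in A)] (@node _ E)).
- rewrite -sum1_card natr_sum big_mkcond /=; apply: eq_bigr => t _.
  by rewrite !indicE inE; case: (_ \in E); case: (_ \in A); rewrite ?mulr0 ?mulr1 ?mul0r.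
- by move=> t t' _ _; exact: node_inj.
- move=> x; split => [[Ex [_ Ax]]|[t /andP[/set_mem Et /set_mem At] <-]].
    have [t tx] := node_surj fE Ex.
    by exists t => //; rewrite /= !tx !mem_set.
  by split => //; split => //; exact: Ar.
Qed.

End config_sum.

(** * The factorial moment formula *)

Section factorial_moment.
Context (R : realType) (k : nat) (r : R).
Hypothesis r0 : 0 < r.
Variable lam : nat -> {finite_measure set R -> \bar R}.
Context d (Omega : measurableType d) (P : probability Omega R)
  (eta : Omega -> set R).
Hypothesis heta : poisson_process P
    (intensity k r (fun l => pushforward (lam l) (fun x => r - x))) eta.
Context (I : finType) (D : {set I}) (lev : I -> nat).
Hypothesis levk : forall b, b \in D -> (lev b < k)%N.
Variables (B : I -> set R) (Q : rel I -> bool).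
Hypothesis mB : forall b, measurable (B b).
Hypothesis Br : forall b, B b `<=` [set x | 0 <= x < r].
Hypothesis Q_local : forall e e' : rel I,
  {in D &, forall b b', e b b' = e' b b'} -> Q e = Q e'.
Hypothesis Q_mono : forall e e' : rel I,
  (forall b b', e b b' -> e' b b') -> Q e -> Q e'.
Hypothesis Q_sep : forall e : rel I, Q e ->
  {in D &, forall b b', b != b' -> lev b = lev b' -> e b b' || e b' b}.

Let slice N (q : {ffun I -> 'I_N.+1}) b := B b `&` [set x | grid N x = q b].

Definition grid_count N w : R :=
  \sum_(q : {ffun I -> 'I_N.+1} | idx_normal D q) (Q (idx_rel q))%:R *
     \prod_(b in D) (cell_count r eta (lev b) (slice q b) w)%:R.

Definition configs w : R :=
  config_sum r D lev (eta w) (fun c => box_ind D B Q (lt_rel c) c).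

(** Each count is a sum over nodes; the product of these sums is distributed and the sums over nodes
    and intervals are exchanged. The definition of [grid_count] serves for means, this form for
    monotonicity and limits in N. *)
Lemma grid_countE N w : grid_count N w =
  config_sum r D lev (eta w) (fun c => box_ind D B Q (grid_rel N c) c).
Proof.
have fE := pp_finite heta w.
rewrite /grid_count /config_sum.
under eq_bigr => q _.
  under eq_bigr => b _.
    rewrite /cell_count npoints_cell //; last by move=> x [/Br].
    over.
  rewrite (big_distr_big (ord0 : 'I_(size (node_seq (eta w))))) big_distrr /=.
  over.
rewrite exchange_big /=; apply: eq_bigr => x _.
rewrite box_ind_gridE // big_distrr; apply: eq_bigr => q _ /=.
by rewrite big_split /= mulrCA.
Qed.

Lemma measurable_grid_count N : measurable_fun [set: Omega] (grid_count N).
Proof.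
rewrite /grid_count; under eq_fun do rewrite -big_filter.
apply: measurable_sum => q; apply: measurable_funM => //.
under eq_fun do rewrite -big_enum.
apply: measurable_prod => b _; apply: (measurable_cell_count heta).
exact: measurable_slice.
Qed.

Lemma mean_grid_count N :
  (\int[P]_w (grid_count N w)%:E =
   \int[iprod_measure (fun b => lam (lev b).+1) (enum D)]_z
     (box_ind D B Q (grid_rel N (iprod_coord z)) (iprod_coord z))%:E)%E.
Proof.
have mc q b : measurable_fun [set: Omega]
    (fun w => (cell_count r eta (lev b) (@slice N q b) w)%:R : R).
  by apply: (measurable_cell_count heta); exact: measurable_slice.
rewrite integral_box_ind_grid // /grid_count.
under eq_integral do rewrite -sumEFin -big_filter.
rewrite ge0_integral_sum //; first last.
- by move=> q w _; rewrite lee_fin mulr_ge0 // prodr_ge0.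
- move=> q; apply/measurable_EFinP; apply: measurable_funM => //.
  under eq_fun do rewrite -big_enum.
  by apply: measurable_prod => b _; exact: mc.
rewrite big_filter; apply: eq_bigr => q _.
under eq_integral do rewrite EFinM.
rewrite ge0_integralZl_EFin //; first last.
- apply/measurable_EFinP; under eq_fun do rewrite -big_enum.
  by apply: measurable_prod => b _; exact: mc.
- by move=> w _; rewrite lee_fin prodr_ge0.
have [Qq|] := boolP (Q (idx_rel q)); last by rewrite !mul0e.
rewrite !mul1e (cell_count_mean_prod r0 heta) //.
- apply: eq_bigr => b _; congr (lam _ _); apply: setIidl => x [/Br /= xr _].
  by rewrite in_itv.
- by move=> b; exact: measurable_slice.
(* For two indices of the same level, [Q_sep] imposes different grid intervals, so the slices are
   disjoint. *)
- move=> b b' bD b'D bb' ll; apply/seteqP; split => x //= -[[_ /= xb] [_ /= xb']].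
  have := Q_sep Qq bD b'D bb' ll.
  by rewrite /idx_rel -xb -xb' ltnn.
Qed.

Let grid_count_ge0 N w : 0 <= grid_count N w.
Proof. by rewrite grid_countE; apply: config_sum_ge0 => c; exact: box_ind_ge0. Qed.

Let grid_count_homo w N M : (N <= M)%N -> grid_count N w <= grid_count M w.
Proof.
move=> NM; rewrite !grid_countE; apply: le_config_sum => c.
exact: box_ind_grid_homo.
Qed.

Let grid_count_cvg w : (grid_count N w)%:E @[N --> \oo] --> (configs w)%:E.
Proof.
(* Finitely many nodes are compared, so the sequence is eventually constant. *)
have [N0 h] := config_sum_near r D lev (eta w) (box_ind_grid_near B Q_local).
apply: cvg_near_cst; exists N0 => // N /= N0N.
by rewrite grid_countE h.
Qed.

Let box_ind_cvg (z : iprod R (enum D)) :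
  (box_ind D B Q (grid_rel N (iprod_coord z)) (iprod_coord z))%:E @[N --> \oo] -->
  (box_ind D B Q (lt_rel (iprod_coord z)) (iprod_coord z))%:E.
Proof.
have [N0 h] := box_ind_grid_near B Q_local (iprod_coord z).
by apply: cvg_near_cst; exists N0 => // N /= N0N; rewrite h.
Qed.

Lemma measurable_configs : measurable_fun [set: Omega] configs.
Proof.
apply/measurable_EFinP; apply: (emeasurable_fun_cvg (fun N w => (grid_count N w)%:E)).
  by move=> N; apply/measurable_EFinP; exact: measurable_grid_count.
by move=> w _; exact: grid_count_cvg.
Qed.

Lemma measurable_box_ind : measurable_fun [set: iprod R (enum D)]
  (fun z => box_ind D B Q (lt_rel (iprod_coord z)) (iprod_coord z)).
Proof.
apply/measurable_EFinP; apply: (emeasurable_fun_cvg (fun N z =>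
  (box_ind D B Q (grid_rel N (iprod_coord z)) (iprod_coord z))%:E)).
  by move=> N; apply/measurable_EFinP; exact: measurable_box_ind_grid.
by move=> w _; exact: box_ind_cvg.
Qed.

(** A multivariate Mecke formula for points that are distinct within each level, as enforced by
    [Q_sep]. The means agree at each grid level; monotone convergence is used once under [P] and
    once, backwards, under the product measure. *)
Lemma mean_configs :
  (\int[P]_w (configs w)%:E =
   \int[iprod_measure (fun b => lam (lev b).+1) (enum D)]_z
     (box_ind D B Q (lt_rel (iprod_coord z)) (iprod_coord z))%:E)%E.
Proof.
transitivity (\int[P]_w limn (fun N => (grid_count N w)%:E))%E.
  by apply: eq_integral => w _; apply/esym/cvg_lim => //; exact: grid_count_cvg.
rewrite monotone_convergence //; first last.
- by move=> w _ N M NM; rewrite lee_fin grid_count_homo.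
- by move=> N w _; rewrite lee_fin.
- by move=> N; apply/measurable_EFinP; exact: measurable_grid_count.
under eq_fun do rewrite mean_grid_count.
rewrite -monotone_convergence //; first last.
- by move=> z _ N M NM; rewrite lee_fin box_ind_grid_homo.
- by move=> N z _; rewrite lee_fin box_ind_ge0.
- by move=> N; apply/measurable_EFinP; exact: measurable_box_ind_grid.
by apply: eq_integral => z _; apply/cvg_lim => //; exact: box_ind_cvg.
Qed.

End factorial_moment.

(** * Null events: nodes at fixed points and ties between cells *)

Section null_events.
Context (R : realType) (k : nat) (r : R).
Hypothesis r0 : 0 < r.
Variable lam : nat -> {finite_measure set R -> \bar R}.
Hypothesis lam0 : forall l x, (l < k)%N -> lam l.+1 [set x] = 0%E.
Context d (Omega : measurableType d) (P : probability Omega R)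
  (eta : Omega -> set R).
Hypothesis heta : poisson_process P
    (intensity k r (fun l => pushforward (lam l) (fun x => r - x))) eta.

(** A singleton has intensity 0 because the measures have no atoms, and a Poisson count of rate 0 is
    almost surely 0. *)
Lemma fixed_node_negligible x : P.-negligible [set w | eta w x].
Proof.
have I0 : intensity k r (fun l => pushforward (lam l) (fun x => r - x)) [set x] = 0%E.
  rewrite /intensity big1_seq // => l; rewrite mem_index_iota => /andP[_].
  case: l => // l lk.
  rewrite /pushforward; set A := _ @^-1` _.
  have /subset_set1[->|->] : A `<=` [set r - (x - l%:R * r)].
  - by move=> y [_ /= <-]; ring.
  - exact: measure0.
  - exact: lam0.
have := pp_law heta [set n | (0 < n)%N] (measurable_set1 x).
rewrite I0 /poisson_prob ltxx /= diracE memNset //= => P0.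
exists [set w | (0 < npoints (eta w `&` [set x]))%N]; split => //.
  have := pp_measurable heta (measurable_set1 x) measurableT (Y := [set n | (0 < n)%N]).
  by rewrite setTI; apply.
move=> w /= etax.
rewrite (@npoints_image unit R xpredT (fun=> x)) ?card_unit //.
  by move=> [] [].
move=> y; split=> [[_ ->]|[_ _ <-]] //; by exists tt.
Qed.

(* The number of pairs of nodes and the number of pairs with distinct
   distances have the same mean, as the diagonal is a null set. *)
Lemma tie_negligible l l' : (l < k)%N -> (l' < k)%N -> l != l' ->
  P.-negligible [set w | exists s s', [/\ eta w s, eta w s',
    0 <= cell_dist r l s < r, 0 <= cell_dist r l' s' < r &
    cell_dist r l s = cell_dist r l' s']].
Proof.
move=> lk l'k ll'.
pose lev (b : bool) := if b then l else l'.
pose B (b : bool) := [set x : R | 0 <= x < r].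
(* The booleans index the two levels: [Q1] imposes nothing, while [Q2] asks for distinct
   distances. *)
pose Q1 (e : rel bool) := true.
pose Q2 (e : rel bool) := e true false || e false true.
pose D : {set bool} := [set: bool]%SET.
have levk b : b \in D -> (lev b < k)%N by case: b.
have mB b : measurable (B b).
  rewrite (_ : B b = `[0, r[%classic) //; apply/seteqP; split => x;
  by rewrite /B /= in_itv.
have Br b : B b `<=` [set x | 0 <= x < r] by [].
(* The two levels differ, so there is nothing to separate. *)
have Q_sep (Q : rel bool -> bool) e : Q e ->
    {in D &, forall b b', b != b' -> lev b = lev b' -> e b b' || e b' b}.
  move=> _ [] [] _ _ //= _ h; exfalso; move/eqP: ll'; apply.
    exact: h.
  exact: esym h.
have Q2_local e e' : {in D &, forall b b', e b b' = e' b b'} -> Q2 e = Q2 e'.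
  by move=> h; rewrite /Q2 !h ?inE.
have Q2_mono (e e' : rel bool) : (forall b b', e b b' -> e' b b') -> Q2 e -> Q2 e'.
  by move=> h /orP[/h|/h] h'; apply/orP; [left|right].
have Q1_local e e' : {in D &, forall b b', e b b' = e' b b'} -> Q1 e = Q1 e' by [].
have Q1_mono (e e' : rel bool) : (forall b b', e b b' -> e' b b') -> Q1 e -> Q1 e' by [].
have E1 := mean_configs r0 heta levk mB Br Q1_local Q1_mono (Q_sep Q1).
have E2 := mean_configs r0 heta levk mB Br Q2_local Q2_mono (Q_sep Q2).
have m1 := measurable_configs heta lev mB Br Q1_local.
have m2 := measurable_configs heta lev mB Br Q2_local.
set C1 := configs _ _ _ _ _ Q1 in E1 m1; set C2 := configs _ _ _ _ _ Q2 in E2 m2.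
have mu0 b x : b \in enum D -> lam (lev b).+1 [set x] = 0%E.
  by move=> _; apply: lam0; apply: levk.
have E12 : (\int[P]_w (C1 w)%:E = \int[P]_w (C2 w)%:E)%E.
  rewrite E1 E2.
  apply: (ge0_eq_integral_null (N := [set z | iprod_coord z true = iprod_coord z false])).
  - exact: measurable_iprod_diag.
  - by apply: (iprod_measure_diag _ _ _ _ mu0); rewrite ?enum_uniq ?mem_enum /D ?inE.
  - by apply/measurable_EFinP; exact: measurable_box_ind.
  - by move=> z; rewrite lee_fin box_ind_ge0.
  - by move=> z; rewrite lee_fin box_ind_ge0.
  - move=> z /= /eqP tf; rewrite /box_ind /Q1 /Q2 /lt_rel.
    by rewrite -neq_lt tf.
(* The common mean is at most the total mass of a finite product measure; its finiteness allows the
   subtraction that gives [D0]. *)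
have fin : (\int[P]_w (C2 w)%:E)%E \is a fin_num.
  rewrite ge0_fin_numE; last first.
    by apply: integral_ge0 => w _; rewrite lee_fin; apply: config_sum_ge0 => c;
      exact: box_ind_ge0.
  rewrite E2; apply: (@le_lt_trans _ _ (\int[iprod_measure
      (fun b => lam (lev b).+1) (enum D)]_z (cst 1%E z)))%E.
    apply: ge0_le_integralT => z; rewrite lee_fin ?box_ind_ge0 //.
    apply: mulr_ile1; rewrite ?prodr_ge0 ?prodr_ile1 //.
      by move=> b _; rewrite indicE; case: (_ \in _); rewrite lexx ler01.
    by case: (Q2 _).
  rewrite integral_cst // mul1e.
  have := @iprod_measure_box _ _ R bool (fun b => lam (lev b).+1) (enum D)
    (fun=> setT) (enum_uniq _) (fun=> measurableT).
  rewrite (_ : [set z | _] = setT) => [->|]; last by apply/seteqP.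
  by rewrite ltey_eq prode_fin_num // => b _; exact: fin_num_measure.
have le21 w : C2 w <= C1 w.
  apply: le_config_sum => c; apply: ler_wpM2l; first exact: prodr_ge0.
  by rewrite ler_nat; case: (Q2 _).
have mD : measurable_fun [set: Omega] (fun w => (C1 w - C2 w)%:E).
  by apply/measurable_EFinP; exact: measurable_funB.
have D0 : (\int[P]_w (C1 w - C2 w)%:E = 0)%E.
  have : (\int[P]_w (C2 w)%:E =
      \int[P]_w (C2 w)%:E + \int[P]_w (C1 w - C2 w)%:E)%E.
    rewrite -[LHS]E12 -ge0_integralD //.
    - by apply: eq_integral => w _; rewrite -EFinD addrC subrK.
    - by move=> w _; rewrite lee_fin; apply: config_sum_ge0 => c; exact: box_ind_ge0.
    - exact/measurable_EFinP.
    - by move=> w _; rewrite lee_fin subr_ge0.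
  rewrite addeC => /(congr1 (fun x => x - \int[P]_w (C2 w)%:E)%E).
  by rewrite subee // addeK // => <-.
have : ae_eq P setT (fun w => (C1 w - C2 w)%:E) (cst 0%E).
  apply/(ae_eq_integral_abs P measurableT mD); rewrite -[RHS]D0.
  by apply: eq_integral => w _; rewrite gee0_abs // lee_fin subr_ge0.
apply: negligibleS => w /= [s [s' [ws ws' zs zs' ss']]] /(_ Logic.I)[] /eqP.
rewrite subr_eq0 => /eqP C12.
have fE := pp_finite heta w.
have [t ts] := node_surj fE ws; have [t' ts'] := node_surj fE ws'.
suff : C2 w < C1 w by rewrite C12 ltxx.
(* A tie provides this configuration, counted by [C1] and not by [C2], against their almost sure
   equality. *)
pose x0 : {ffun bool -> 'I_(size (node_seq (eta w)))} :=
  [ffun b => if b then t else t'].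
have zx0 b : node_dist r lev x0 b = cell_dist r l s.
  by case: b; rewrite /node_dist ffunE /= ?ts ?ts'.
have x0in : x0 \in pffun_on (ord0 : 'I_(size (node_seq (eta w)))) [in D] predT.
  by apply/pffun_onP; split => [|//]; apply/fintype.subsetP => b _; rewrite !inE.
rewrite /C1 /C2 /configs /config_sum (bigD1 x0) //= [ltRHS](bigD1 x0) //=.
apply: ltr_leD; last first.
  apply: ler_sum => x _; apply: ler_wpM2l; first exact: prodr_ge0.
  apply: ler_wpM2l; first exact: prodr_ge0.
  by rewrite ler_nat; case: (Q2 _).
have Wx0 : \prod_(b in D) \1_(eta w) (node (x0 b)) = 1 :> R.
  by rewrite big1 // => -[] _; rewrite ffunE indicE ?ts ?ts' mem_set.
have Bx0 : \prod_(b in D) \1_(B b) (node_dist r lev x0 b) = 1 :> R.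
  by rewrite big1 // => b _; rewrite zx0 indicE mem_set.
by rewrite /box_ind Wx0 Bx0 !mul1r /Q2 /lt_rel !zx0 ltxx ltr_nat.
Qed.

Lemma ties_negligible :
  P.-negligible [set w | exists l l' s s', [/\ (l < k)%N, (l' < k)%N & l != l'] /\
    [/\ eta w s, eta w s', 0 <= cell_dist r l s < r, 0 <= cell_dist r l' s' < r &
    cell_dist r l s = cell_dist r l' s']].
Proof.
rewrite (_ : [set w | _] = \bigcup_l \bigcup_l' [set w | exists s s',
    [/\ (l < k)%N, (l' < k)%N & l != l'] /\
    [/\ eta w s, eta w s', 0 <= cell_dist r l s < r, 0 <= cell_dist r l' s' < r &
    cell_dist r l s = cell_dist r l' s']]); last first.
  apply/seteqP; split => w /=; first by move=> [l [l' h]]; exists l => //; exists l'.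
  by move=> [l _ [l' _ h]]; exists l, l'.
apply: negligible_bigcup => l; apply: negligible_bigcup => l'.
have [[lk l'k ll']|h] := pselect [/\ (l < k)%N, (l' < k)%N & l != l'].
  apply: negligibleS (tie_negligible lk l'k ll') => w /= [s [s' [_ h]]].
  by exists s, s'.
apply: negligibleS (negligible_set0 P) => w /= [s [s' [h' _]]]; exact: h.
Qed.

End null_events.

(** * Hops as increasing chains of distances *)

Section hops.
Context (R : realType) (k : nat) (r : R) (E : set R).
Hypothesis k2 : (2 <= k)%N.
Hypothesis r0 : 0 < r.
Hypothesis E_fin : finite_set E.
Hypothesis E_grid : forall m : nat, ~ E (m%:R * r).
Hypothesis E_ties : forall l l' s s', (l < k)%N -> (l' < k)%N -> l != l' ->
  E s -> E s' -> 0 <= cell_dist r l s < r -> 0 <= cell_dist r l' s' < r ->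
  cell_dist r l s <> cell_dist r l' s'.

(** With z_j = j r - u_j, where u_0 = 0, u_k = k r - tau and the other u_j are the nodes, an edge is
    the condition 0 <= z_(j+1) - z_j <= 2 r. Hence z increases from z_0 = 0 to z_k = tau <= r, which
    puts each node in its own cell; [E_grid] and [E_ties] make the bounds strict. Conversely,
    increasing values in [0, r] have steps of at most r. *)
Lemma khops_cells (s : seq R) (tau : R) : 0 <= tau <= r -> size s = k.-1 ->
  [set` s] `<=` E ->
  (uniq s /\ path (connected_nodes r) 0 (rcons s (k%:R * r - tau))) <->
  ((forall i, (i < k.-1)%N -> 0 <= cell_dist r i (nth 0 s i) < r /\
      cell_dist r i (nth 0 s i) <= tau) /\
   (forall i, (i.+1 < k.-1)%N ->
      cell_dist r i (nth 0 s i) < cell_dist r i.+1 (nth 0 s i.+1))).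
Proof.
move=> /andP[tau0 taur] ss sE; have kK : k = k.-1.+1 by rewrite prednK // ltnW.
pose u j := nth 0 (0 :: rcons s (k%:R * r - tau)) j.
(* Index 0 is the start and index k the endpoint, so [z i.+1] belongs to entry i of [s], in cell
   i. *)
pose z j := j%:R * r - u j.
have z0 : z 0%N = 0 by rewrite /z /u /= mul0r subr0.
have zS i : (i < k.-1)%N -> z i.+1 = cell_dist r i (nth 0 s i).
  by move=> iK; rewrite /z /u /= nth_rcons ss iK.
have zk : z k = tau.
  by rewrite /z /u kK /= nth_rcons ss ltnn eqxx -kK; ring.
have pathE : path (connected_nodes r) 0 (rcons s (k%:R * r - tau)) <->
    (forall j, (j < k)%N -> `|r - (z j.+1 - z j)| <= r).
  have e j : r - (z j.+1 - z j) = u j.+1 - u j by rewrite /z -natr1; ring.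
  split => [/(pathP 0) h j jk|h].
    by rewrite e; apply: h; rewrite size_rcons ss -kK.
  by apply/(pathP 0) => j; rewrite size_rcons ss -kK => /h; rewrite e.
split=> [[us /pathE h]|[hc hs]].
  have step j : (j < k)%N -> z j <= z j.+1.
    by move=> /h; rewrite ler_norml => /andP[_]; lra.
  have homo i j : (i <= j)%N -> (j <= k)%N -> z i <= z j.
    move=> /subnK <-; elim: (j - i)%N => // m IH mk.
    by apply: le_trans (IH (ltnW mk)) _; exact: step.
  have cellP i : (i < k.-1)%N -> 0 <= cell_dist r i (nth 0 s i) < r /\
      cell_dist r i (nth 0 s i) <= tau.
    move=> iK; have ik : (i.+1 <= k)%N by rewrite kK ltnW.
    have zt : z i.+1 <= tau by rewrite -zk; apply: homo.
    have zp : 0 <= z i.+1 by rewrite -z0; apply: homo.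
    rewrite -zS //; split => //; rewrite zp lt_neqAle (le_trans zt taur) andbT.
    (* A distance equal to r would put a node at the multiple i r. *)
    apply/eqP => zr; apply: (E_grid (m := i)); apply: sE => /=.
    suff -> : i%:R * r = nth 0 s i by rewrite mem_nth // ss.
    by move: zr; rewrite zS // /cell_dist -natr1; lra.
  split=> // i iK; have iK' := ltnW iK.
  have ik : (i.+1 < k)%N by rewrite kK; exact: ltnW.
  rewrite lt_neqAle -!zS // step // andbT !zS //; apply/eqP.
  apply: E_ties => //; first exact: ltnW.
  - by rewrite ltn_eqF.
  - by apply: sE => /=; rewrite mem_nth // ss.
  - by apply: sE => /=; rewrite mem_nth // ss.
  - by have [] := cellP i iK'.
  - by have [] := cellP _ iK.
split.
  (* Entries with different indices lie in different cells. *)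
  apply/(uniqP 0) => i j; rewrite !inE ss => iK jK nij.
  have [ci _] := hc i iK; have [cj _] := hc j jK; rewrite nij in ci.
  exact: cell_level ci cj.
have zb j : (j <= k)%N -> 0 <= z j <= r.
  case: j => [_|j]; first by rewrite z0 lexx ltW.
  rewrite leq_eqVlt => /orP[/eqP ->|]; first by rewrite zk tau0.
  rewrite kK ltnS => jK; rewrite zS //.
  by have [/andP[-> /ltW ->] _] := hc j jK.
apply/pathE => j jk; have := zb j (ltnW jk); have := zb _ jk.
have st : z j <= z j.+1; last by rewrite ler_norml; lra.
case: j jk => [k0|j jk]; first by rewrite z0; case/andP: (zb 1%N k0).
have jK : (j < k.-1)%N by rewrite -ltnS -kK.
move: jk; rewrite leq_eqVlt => /orP[/eqP jk|].
  by rewrite jk zk zS //; case: (hc j jK).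
by rewrite kK ltnS => jK'; rewrite !zS // ltW // hs.
Qed.

Definition hop_nodes (tau : R) (y : {ffun 'I_k.-1 -> 'I_(size (node_seq E))}) : bool :=
  [forall m : 'I_k.-1, [&& node (y m) \in E,
     0 <= cell_dist r m (node (y m)) < r & cell_dist r m (node (y m)) <= tau]] &&
  sorted <%R [seq cell_dist r m (node (y m)) | m : 'I_k.-1 <- enum 'I_k.-1].

(** Listing the node chosen in each cell is a bijection from the index functions satisfying
    [hop_nodes] onto the hops, so the count becomes a finite sum. *)
Lemma sigma_khopE tau : 0 <= tau <= r ->
  sigma_khop k r E (k%:R * r - tau) = #|hop_nodes tau|.
Proof.
move=> htau; pose f (y : {ffun 'I_k.-1 -> 'I_(size (node_seq E))}) :=
  [seq node (y m) | m : 'I_k.-1 <- enum 'I_k.-1].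
have sf y : size (f y) = k.-1 by rewrite size_map size_enum_ord.
have nthf y (i : 'I_k.-1) : nth 0 (f y) i = node (y i).
  by rewrite (nth_map i) ?size_enum_ord // nth_ord_enum.
have nthc (y : {ffun 'I_k.-1 -> 'I_(size (node_seq E))}) (i : 'I_k.-1) :
    nth 0 [seq cell_dist r m (node (y m)) | m : 'I_k.-1 <- enum 'I_k.-1] i
    = cell_dist r i (node (y i)).
  by rewrite (nth_map i) ?size_enum_ord // nth_ord_enum.
apply: (npoints_image (f := f)).
  move=> y y' _ _ yy'; apply/ffunP => m; apply: node_inj.
  by rewrite -!nthf yy'.
have hopE y : [set` f y] `<=` E -> hop_nodes tau y <->
  ((forall i, (i < k.-1)%N -> 0 <= cell_dist r i (nth 0 (f y) i) < r /\
      cell_dist r i (nth 0 (f y) i) <= tau) /\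
   (forall i, (i.+1 < k.-1)%N ->
      cell_dist r i (nth 0 (f y) i) < cell_dist r i.+1 (nth 0 (f y) i.+1))).
  move=> fE; split.
    move=> /andP[/forallP h /(sortedP 0)]; rewrite size_map size_enum_ord => hs.
    split => i iK.
      by have /and3P[_ hc ht] := h (Ordinal iK); rewrite (nthf y (Ordinal iK)).
    have := hs i iK; rewrite (nthf y (Ordinal iK)) (nthc y (Ordinal iK)).
    by rewrite (nthf y (Ordinal (ltnW iK))) (nthc y (Ordinal (ltnW iK))).
  move=> [hc hs]; apply/andP; split.
    apply/forallP => m; have [c t] := hc m (ltn_ord m); rewrite nthf in c t.
    rewrite c t !andbT; apply: mem_set; apply: fE => /=.
    by apply: map_f; rewrite mem_enum.
  apply/(sortedP 0) => i; rewrite size_map size_enum_ord => iK.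
  have := hs i iK; rewrite (nthf y (Ordinal iK)) (nthc y (Ordinal iK)).
  by rewrite (nthf y (Ordinal (ltnW iK))) (nthc y (Ordinal (ltnW iK))).
move=> s; split.
  move=> [ss us sE ps].
  have /choice[y0 y0P] (m : 'I_k.-1) : exists t : 'I_(size (node_seq E)), node t = nth 0 s m.
    by apply: node_surj => //; apply: sE; rewrite /= mem_nth // ss.
  pose y := [ffun m => y0 m].
  have fy : f y = s.
    apply: (@eq_from_nth _ 0); rewrite sf // => i iK.
    by rewrite (nthf y (Ordinal iK)) ffunE y0P.
  exists y => //; apply/hopE; rewrite fy //.
  by apply/(khops_cells htau ss sE).
move=> [y hy <-].
have fE : [set` f y] `<=` E.
  move=> x /= /mapP[m _ ->]; have /andP[/forallP/(_ m)/and3P[h _ _] _] := hy.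
  exact: set_mem.
have [us ps] := (khops_cells htau (sf y) fE).2 ((hopE y fE).1 hy).
by split.
Qed.

End hops.

(** * Arrays of points and their coincidence partitions *)

Section kernel_partition.
Context (k n : nat).
Implicit Type p : {ffun 'I_k.-1 -> {set {set 'I_n}}}.

Definition blockset p : {set 'I_k.-1 * {set 'I_n}} :=
  [set x : 'I_k.-1 * {set 'I_n} | x.2 \in p x.1]%SET.

Lemma partition_familiesP p : p \in partition_families k n ->
  forall l, finset.partition (p l) [set: 'I_n]%SET.
Proof. by rewrite inE => /forallP. Qed.

Lemma pblock_blockset p l i : p \in partition_families k n ->
  (l, finset.pblock (p l) i) \in blockset p.
Proof.
move=> /partition_familiesP/(_ l)/and3P[/eqP cp _ _].
by rewrite inE /= pblock_mem // cp inE.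
Qed.

Lemma mem_pblock_family p l i : p \in partition_families k n ->
  i \in finset.pblock (p l) i.
Proof.
by move=> /partition_familiesP/(_ l)/and3P[/eqP cp _ _]; rewrite mem_pblock cp inE.
Qed.

Lemma pblock_family p l b i : p \in partition_families k n ->
  (l, b) \in blockset p -> i \in b -> finset.pblock (p l) i = b.
Proof.
move=> /partition_familiesP/(_ l)/and3P[_ tp _]; rewrite inE /= => pb ib.
exact: def_pblock.
Qed.

Lemma blockset_neq0 p x : p \in partition_families k n ->
  x \in blockset p -> exists i, i \in x.2.
Proof.
move=> /partition_familiesP/(_ x.1)/and3P[_ _ p0]; rewrite inE => xp.
by apply/set0Pn; apply: contraNneq p0 => <-.
Qed.

Context (T : finType) (t0 : T).

Definition kernel_family (Y : {ffun 'I_n -> {ffun 'I_k.-1 -> T}}) :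
    {ffun 'I_k.-1 -> {set {set 'I_n}}} :=
  [ffun l => preim_partition (fun i => Y i l) [set: 'I_n]%SET].

Definition spread p (x : {ffun 'I_k.-1 * {set 'I_n} -> T}) :
    {ffun 'I_n -> {ffun 'I_k.-1 -> T}} :=
  [ffun i => [ffun l => x (l, finset.pblock (p l) i)]].

Definition level_injective p (x : {ffun 'I_k.-1 * {set 'I_n} -> T}) : bool :=
  [forall b in blockset p, forall b' in blockset p,
    (b.1 == b'.1) && (x b == x b') ==> (b == b')].

(** A left inverse of [spread] on levelwise injective choices. If [p] is the coincidence family of
    [Y], all rows in a block carry the same point, so any row may be picked; the value [t0] off the
    blocks matches [pffun_on]. *)
Definition gather p (Y : {ffun 'I_n -> {ffun 'I_k.-1 -> T}}) :
    {ffun 'I_k.-1 * {set 'I_n} -> T} :=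
  [ffun b => if b \in blockset p then
     if [pick i in b.2] is Some i then Y i b.1 else t0 else t0].

Lemma kernel_family_in Y : kernel_family Y \in partition_families k n.
Proof. by rewrite inE; apply/forallP => l; rewrite ffunE; exact: preim_partitionP. Qed.

Lemma spread_gather p Y : p \in partition_families k n -> kernel_family Y = p ->
  spread p (gather p Y) = Y.
Proof.
move=> pP Yp; apply/ffunP => i; apply/ffunP => l; rewrite !ffunE pblock_blockset //=.
case: pickP => [j|/(_ i)]; last by rewrite mem_pblock_family.
have -> : p l = preim_partition (fun i => Y i l) [set: 'I_n]%SET by rewrite -Yp ffunE.
rewrite /preim_partition pblock_equivalence_partition ?inE //.
  by move=> /eqP.
by split => // /eqP ->.
Qed.

(** This identifies the side condition produced by [reindex_onto]. Two blocks of one level carrying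
    the same point would be merged in the coincidence partition, so recovering [p] amounts to
    levelwise injectivity. *)
Lemma spread_kernel p x : p \in partition_families k n ->
  (kernel_family (spread p x) == p) && (gather p (spread p x) == x) =
  (x \in pffun_on t0 [in blockset p] predT) && level_injective p x.
Proof.
move=> pP; apply/andP/andP => -[].
  move=> /eqP ker /eqP gx; split.
    apply/pffun_onP; split => //; apply/fintype.subsetP => b; apply: contraR => bD.
    by rewrite -gx ffunE (negbTE bD).
  apply/forallP => b; apply/implyP => bD; apply/forallP => b'; apply/implyP => b'D.
  apply/implyP => /andP[/eqP ll /eqP xx].
  have [i ib] := blockset_neq0 pP bD; have [i' ib'] := blockset_neq0 pP b'D.
  case: b b' bD b'D ll xx ib ib' => [l b] [l' b'] /= bD b'D ll xx ib ib'; subst l'.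
  have bE := pblock_family pP bD ib; have b'E := pblock_family pP b'D ib'.
  suff : i' \in finset.pblock (p l) i.
    by rewrite bE => i'b; rewrite -b'E (pblock_family pP bD i'b).
  rewrite -{1}ker ffunE /preim_partition pblock_equivalence_partition ?inE //.
    by rewrite !ffunE bE b'E xx.
  by split => // /eqP ->.
move=> /pffun_onP[xs _] /forallP inj.
have injP l i i' : x (l, finset.pblock (p l) i) = x (l, finset.pblock (p l) i') ->
    finset.pblock (p l) i = finset.pblock (p l) i'.
  move=> xx; have := inj (l, finset.pblock (p l) i).
  rewrite pblock_blockset //= => /forallP/(_ (l, finset.pblock (p l) i')).
  by rewrite pblock_blockset //= xx !eqxx /= => /eqP[].
split.
  apply/eqP/ffunP => l; rewrite ffunE.
  rewrite -[RHS](preim_partition_pblock (partition_familiesP pP l)).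
  apply: eq_imset => i /=; apply/setP => j; rewrite !inE !ffunE.
  by apply/eqP/eqP => [/injP|->].
apply/eqP/ffunP => b; rewrite ffunE; case: ifPn => bD; last first.
  apply/eqP; rewrite eq_sym; apply: contraR bD => xb.
  exact: (fintype.subsetP xs).
case: pickP => [i ib|b0].
  by rewrite !ffunE; case: b bD ib => l b bD ib /=; rewrite (pblock_family pP bD ib).
by have [i] := blockset_neq0 pP bD; rewrite b0.
Qed.

(* An array of points amounts to its levelwise coincidence partitions together
   with a levelwise injective choice of one point per block. *)
Lemma sum_kernel_family (V : nmodType) (F : {ffun 'I_n -> {ffun 'I_k.-1 -> T}} -> V) :
  \sum_Y F Y = \sum_(p in partition_families k n)
    \sum_(x in pffun_on t0 [in blockset p] predT | level_injective p x)
      F (spread p x).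
Proof.
rewrite (partition_big kernel_family (mem (partition_families k n))) /=; last first.
  by move=> Y _; exact: kernel_family_in.
apply: eq_bigr => p pP.
rewrite (reindex_onto (spread p) (gather p)) /=; last first.
  by move=> Y /eqP Yp; exact: spread_gather.
by apply: eq_bigl => x; rewrite spread_kernel.
Qed.

End kernel_partition.

Lemma prodr_bool (R : comPzSemiRingType) (I : finType) (D : pred I) (b : I -> bool) :
  \prod_(i | D i) (b i)%:R = [forall i, D i ==> b i]%:R :> R.
Proof.
have [/forallP h|/forallPn[i]] := boolP [forall i, D i ==> b i].
  by rewrite big1 // => i Di; have := h i; rewrite Di /= => ->.
by rewrite negb_imply => /andP[Di bi]; rewrite (bigD1 i) //= (negbTE bi) mul0r.
Qed.

Lemma tau_hatP (R : realType) n (r : R) (tau : 'I_n -> R) (b : {set 'I_n}) x :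
  x <= r -> (x <= tau_hat r tau b) <-> (forall i, i \in b -> x <= tau i).
Proof.
move=> xr; split=> [xb i ib|xb]; last exact: le_bigmin.
by apply: le_trans xb _; exact: bigmin_le_cond.
Qed.

(** * Order conditions and boxes indexed by blocks *)

Section block_rel.
Context (k n : nat).
Implicit Type p : {ffun 'I_k.-1 -> {set {set 'I_n}}}.

Definition block_level (b : 'I_k.-1 * {set 'I_n}) : nat := b.1.

Definition block_sorted p (e : rel ('I_k.-1 * {set 'I_n})) : bool :=
  [forall i, sorted (fun m m' => e (m, finset.pblock (p m) i)
                                   (m', finset.pblock (p m') i)) (enum 'I_k.-1)].

(** Distinctness of the points of a level, phrased with comparisons so that it is monotone in [e]
    and puts the points in different grid intervals. *)
Definition block_sep p (e : rel ('I_k.-1 * {set 'I_n})) : bool :=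
  [forall b in blockset p, forall b' in blockset p,
    (b != b') && (b.1 == b'.1) ==> e b b' || e b' b].

Definition block_rel p (e : rel ('I_k.-1 * {set 'I_n})) : bool :=
  block_sep p e && block_sorted p e.

Lemma block_rel_local p : p \in partition_families k n -> forall e e' : rel _,
  {in blockset p &, forall b b', e b b' = e' b b'} -> block_rel p e = block_rel p e'.
Proof.
move=> pP e e' ee'; congr (_ && _).
  apply: eq_forallb => b; have [bD|//] := boolP (b \in _).
  apply: eq_forallb => b'; have [b'D|//] := boolP (b' \in _).
  by rewrite !ee'.
apply: eq_forallb => i; apply: eq_sorted => m m'.
by rewrite ee' // pblock_blockset.
Qed.

Lemma block_rel_mono p (e e' : rel _) :
  (forall b b', e b b' -> e' b b') -> block_rel p e -> block_rel p e'.
Proof.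
move=> ee' /andP[/forallP sep /forallP srt]; apply/andP; split; apply/forallP.
  move=> b; apply/implyP => bD; apply/forallP => b'; apply/implyP => b'D.
  apply/implyP => h; have := sep b; rewrite bD /= => /forallP/(_ b').
  rewrite b'D h /= => /orP[/ee' ->//|/ee' ->]; exact: orbT.
by move=> i; apply: sub_sorted (srt i) => m m'; exact: ee'.
Qed.

Lemma block_rel_sep p (e : rel _) : block_rel p e ->
  {in blockset p &, forall b b', b != b' -> block_level b = block_level b' ->
    e b b' || e b' b}.
Proof.
move=> /andP[/forallP sep _] b b' bD b'D bb' /val_inj ll.
have := sep b; rewrite bD /= => /forallP/(_ b').
by rewrite b'D bb' ll eqxx.
Qed.

(** The bound x < r comes from the cell. As [tau_hat] is at most r, it removes at most the point r
    from the range [0, [tau_hat]] of the formula. *)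
Definition block_box (R : realType) (r : R) (tau : 'I_n -> R)
    (b : 'I_k.-1 * {set 'I_n}) : set R :=
  [set x | 0 <= x < r /\ x <= tau_hat r tau b.2].

Lemma measurable_block_box (R : realType) (r : R) (tau : 'I_n -> R) b :
  measurable (block_box r tau b).
Proof.
rewrite (_ : block_box r tau b = `[0, r[ `&` `]-oo, (tau_hat r tau b.2)]).
  exact: measurableI.
by apply/seteqP; split => x; rewrite /block_box /= !in_itv /=.
Qed.

End block_rel.

(** * The product of the hop counts as a sum over partition families *)

Section sigma_product.
Context (R : realType) (k : nat) (r : R) (E : set R).
Hypothesis k2 : (2 <= k)%N.
Hypothesis r0 : 0 < r.
Hypothesis E_fin : finite_set E.
Hypothesis E_grid : forall m : nat, ~ E (m%:R * r).
Hypothesis E_ties : forall l l' s s', (l < k)%N -> (l' < k)%N -> l != l' ->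
  E s -> E s' -> 0 <= cell_dist r l s < r -> 0 <= cell_dist r l' s' < r ->
  cell_dist r l s <> cell_dist r l' s'.
Context (n : nat) (tau : 'I_n -> R).
Hypothesis htau : forall i, 0 <= tau i <= r.

(** Conditions on rows become conditions on blocks: the bounds by [tau i] over the rows of a block
    combine into [tau_hat], and distinct nodes of one cell have distinct distances. *)
Lemma hop_nodes_spread p (x : {ffun 'I_k.-1 * {set 'I_n} -> 'I_(size (node_seq E))}) :
  p \in partition_families k n ->
  level_injective p x && [forall i, hop_nodes r (tau i) (spread p x i)] =
  [&& [forall b, (b \in blockset p) ==> (node (x b) \in E)],
     [forall b, (b \in blockset p) ==>
        (node_dist r (@block_level k n) x b \in block_box r tau b)] &
     block_rel p (lt_rel (node_dist r (@block_level k n) x))].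
Proof.
move=> pP; pose z := node_dist r (@block_level k n) x; rewrite -/z.
have srtE i : sorted <%R [seq cell_dist r m (node (spread p x i m)) | m : 'I_k.-1 <- enum 'I_k.-1] =
    sorted (fun m m' => lt_rel z (m, finset.pblock (p m) i)
                                 (m', finset.pblock (p m') i)) (enum 'I_k.-1).
  rewrite sorted_map; apply: eq_sorted => m m' /=.
  by rewrite /lt_rel /z /node_dist !ffunE.
apply/andP/and3P => -[].
  move=> /forallP inj /forallP hop.
  have hopP b : b \in blockset p -> [/\ node (x b) \in E, 0 <= z b < r &
      forall i, i \in b.2 -> z b <= tau i].
    move=> bD; have [i0 i0b] := blockset_neq0 pP bD.
    have key i : i \in b.2 -> [/\ node (x b) \in E, 0 <= z b < r & z b <= tau i].
      move=> ib; have /andP[/forallP/(_ b.1)/and3P[]] := hop i.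
      rewrite !ffunE; case: b bD ib {i0b} => l b bD ib.
      by rewrite (pblock_family pP bD ib).
    by have [? ? _] := key _ i0b; split => // i /key[].
  split.
  - by apply/forallP => b; apply/implyP => /hopP[].
  - apply/forallP => b; apply/implyP => /hopP[_ zb zt]; apply/mem_set; split => //.
    by apply/tau_hatP => //; case/andP: zb => _ /ltW.
  apply/andP; split.
    apply/forallP => b; apply/implyP => bD; apply/forallP => b'; apply/implyP => b'D.
    apply/implyP => /andP[bb' ll]; rewrite /lt_rel -neq_lt; apply: contra bb' => zz.
    have := inj b; rewrite bD /= => /forallP/(_ b'); rewrite b'D ll /= => /implyP; apply.
    apply/eqP/node_inj; move/eqP: zz; rewrite /z /node_dist /block_level (eqP ll).
    by rewrite /cell_dist => /addrI/oppr_inj.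
  by apply/forallP => i; rewrite -srtE; have /andP[] := hop i.
move=> /forallP nE /forallP nB /andP[/forallP sep /forallP srt].
split.
  apply/forallP => b; apply/implyP => bD; apply/forallP => b'; apply/implyP => b'D.
  apply/implyP => /andP[ll /eqP xx]; apply/negPn/negP => bb'.
  have := sep b; rewrite bD /= => /forallP/(_ b'); rewrite b'D ll bb' /=.
  by rewrite /lt_rel /z /node_dist /block_level (eqP ll) xx ltxx.
apply/forallP => i; apply/andP; split; last by rewrite srtE; exact: srt.
apply/forallP => m; rewrite !ffunE; have bD := pblock_blockset m i pP.
have := nB (m, finset.pblock (p m) i); rewrite bD /= => /set_mem[zb zt].
have := nE (m, finset.pblock (p m) i); rewrite bD /= => ->.
move: (zb) => -> /=; move/tau_hatP : zt; apply; last exact: mem_pblock_family.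
by case/andP: zb => _ /ltW.
Qed.

(** Distributing the product over the sums gives arrays with one hop per row; [sum_kernel_family]
    sorts them by coincidences and [hop_nodes_spread] rewrites each class as a [config_sum]. *)
Lemma prod_sigma_khop :
  \prod_(i < n) (sigma_khop k r E (k%:R * r - tau i))%:R =
  \sum_(p in partition_families k n)
    config_sum r (blockset p) (@block_level k n) E
      (fun c => box_ind (blockset p) (block_box r tau) (block_rel p) (lt_rel c) c) :> R.
Proof.
have sE i : (sigma_khop k r E (k%:R * r - tau i))%:R =
    \sum_(y : {ffun 'I_k.-1 -> 'I_(size (node_seq E))}) (hop_nodes r (tau i) y)%:R :> R.
  rewrite sigma_khopE // -sum1_card natr_sum big_mkcond /=.
  by apply: eq_bigr => y _; rewrite -topredE /=; case: hop_nodes.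
under eq_bigr do rewrite sE.
rewrite bigA_distr_bigA (sum_kernel_family (ord0 : 'I_(size (node_seq E)))).
apply: eq_bigr => p pP; rewrite /config_sum big_mkcondr /=; apply: eq_bigr => x _.
rewrite /box_ind !prodr_bool -!natrM !mulnb -hop_nodes_spread //.
by case: level_injective; rewrite // prodr_bool.
Qed.

End sigma_product.

(** * Comparison of the integrals and conclusion *)

Lemma negligible_exists d (T : measurableType d) (R : realType)
    (mu : {measure set T -> \bar R}) (I : countType) (F : I -> set T) :
  (forall i, mu.-negligible (F i)) -> mu.-negligible [set x | exists i, F i x].
Proof.
move=> nF; apply: (@negligibleS _ _ _ mu (\bigcup_j
    if choice.unpickle j is Some i then F i else set0)).
  by move=> x [i Fx]; exists (choice.pickle i) => //; rewrite choice.pickleK.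
apply: negligible_bigcup => j; case: choice.unpickle => [i|]; first exact: nF.
exact: negligible_set0.
Qed.

(** The two integrands differ only where two block coordinates coincide or some coordinate equals r,
    which is a null set for the product of atomless measures. *)
Lemma integral_block_box (R : realType) (k : nat) (r : R)
    (lam : nat -> {finite_measure set R -> \bar R}) (n : nat) (tau : 'I_n -> R)
    (p : {ffun 'I_k.-1 -> {set {set 'I_n}}}) :
  (2 <= k)%N -> (forall l x, (l < k)%N -> lam l.+1 [set x] = 0%E) ->
  p \in partition_families k n ->
  (\int[iprod_measure (fun b : 'I_k.-1 * {set 'I_n} => lam b.1.+1) (blocks p)]_(z in
       [set z | forall b, b \in blocks p ->
                    (0 <= (iprod_coord z b : R) <= tau_hat r tau b.2)%R])
       (\prod_(l < k.-1) \prod_(b in p l) \prod_(i in b)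
         (sorted <%R [seq (iprod_coord z (m, finset.pblock (p m) i) : R)
                      | m <- enum 'I_k.-1])%:R)%:E =
   \int[iprod_measure (fun b : 'I_k.-1 * {set 'I_n} => lam b.1.+1)
       (enum (blockset p))]_z
     (box_ind (blockset p) (block_box r tau) (block_rel p)
        (lt_rel (iprod_coord z)) (iprod_coord z))%:E)%E.
Proof.
move=> k2 lam0 pP; rewrite integral_mkcond.
have bk (b : 'I_k.-1 * {set 'I_n}) : (b.1 < k)%N.
  by rewrite (leq_trans (ltn_ord b.1)) // leq_pred.
set mu := iprod_measure _ _.
have nD b b' : mu.-negligible [set z | [/\ b \in blockset p, b' \in blockset p,
    b != b' & iprod_coord z b = iprod_coord z b' :> R]].
  have [h|h] := pselect [/\ b \in blockset p, b' \in blockset p & b != b'].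
    case: h => bD b'D bb'; exists [set z | iprod_coord z b = iprod_coord z b'].
    split; [exact: measurable_iprod_diag| |by move=> z []].
    apply: iprod_measure_diag => //; rewrite ?enum_uniq ?mem_enum //.
    by move=> i x _; exact: lam0.
  apply: negligibleS (negligible_set0 mu) => z [bD b'D bb' _]; exact: h.
have nr b : mu.-negligible [set z | b \in blockset p /\ iprod_coord z b = r].
  have [bD|bD] := boolP (b \in blockset p); last first.
    apply: negligibleS (negligible_set0 mu) => z [bD' _]; exact: (negP bD).
  pose A (b' : 'I_k.-1 * {set 'I_n}) : set R := if b' == b then [set r] else setT.
  have mA b' : measurable (A b') by rewrite /A; case: ifP.
  exists [set z | forall b', b' \in enum (blockset p) -> A b' (iprod_coord z b')].
  split; first exact: measurable_iprod_box.
    rewrite iprod_measure_box ?enum_uniq // (bigD1_seq b) ?enum_uniq ?mem_enum //=.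
    by rewrite /A eqxx lam0 ?mul0e.
  by move=> z [_ zb] b' _; rewrite /A; case: eqP => // ->.
have := negligibleU (negligible_exists (fun b => negligible_exists (nD b)))
  (negligible_exists nr).
move=> [N [mN N0 badN]].
apply: (ge0_eq_integral_null mN N0).
- apply/measurable_EFinP; apply: measurable_box_ind.
  + by move=> b; exact: measurable_block_box.
  + exact: block_rel_local.
- move=> z; apply: erestrict_ge0 => z' _; rewrite lee_fin.
  by do 3! (apply: prodr_ge0 => ? _).
- by move=> z; rewrite lee_fin box_ind_ge0.
move=> z Nz; have zD b b' : b \in blockset p -> b' \in blockset p -> b != b' ->
    iprod_coord z b <> iprod_coord z b' :> R.
  by move=> bD b'D bb' zz; apply: Nz; apply: badN; left; exists b, b'.
have zr b : b \in blockset p -> iprod_coord z b <> r.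
  by move=> bD zbr; apply: Nz; apply: badN; right; exists b.
rewrite /patch; case: ifPn => [/set_mem zbox|/negP zbox]; last first.
  have [b [bD zb]] : exists b, b \in blockset p /\
      ~ (0 <= (iprod_coord z b : R) <= tau_hat r tau b.2).
    apply: contrapT => h; apply: zbox; apply/mem_set => b bD.
    by apply: contrapT => zb; apply: h; exists b; split => //; rewrite -mem_enum.
  rewrite /box_ind (bigD1 b) //= indicE memNset ?mul0r // => -[/andP[z0 _] zt].
  by apply: zb; rewrite z0.
congr EFin; rewrite /box_ind [X in _ = X * _]big1 ?mul1r; last first.
  move=> b bD; rewrite indicE mem_set //.
  have /andP[z0 zt] : 0 <= (iprod_coord z b : R) <= tau_hat r tau b.2.
    by apply: zbox; rewrite mem_enum.
  split => //; rewrite z0 lt_neqAle (le_trans zt (bigmin_le_id _ _ _ _)) andbT.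
  exact/eqP/zr.
(* Off the diagonals the separation condition holds automatically. *)
have -> : block_rel p (lt_rel (iprod_coord z)) = block_sorted p (lt_rel (iprod_coord z)).
  rewrite /block_rel (_ : block_sep p _ = true) //.
  apply/forallP => b; apply/implyP => bD; apply/forallP => b'; apply/implyP => b'D.
  apply/implyP => /andP[bb' _]; rewrite /lt_rel -neq_lt; apply/eqP; exact: zD.
under eq_bigr do under eq_bigr do rewrite prodr_bool.
under eq_bigr do rewrite prodr_bool.
rewrite prodr_bool; congr (nat_of_bool _)%:R.
(* The factor of row i does not depend on the level or the block, so the product is one condition
   per row. As k >= 2, level 0 exists and one of its blocks contains i. *)
have k0 : (0 < k.-1)%N by rewrite -ltnS prednK // ltnW.
apply/forallP/forallP => [h i|h l].
  have := h (Ordinal k0) => /= /forallP/(_ (finset.pblock (p (Ordinal k0)) i)).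
  have := pblock_blockset (Ordinal k0) i pP; rewrite inE /= => -> /=.
  by move=> /forallP/(_ i); rewrite mem_pblock_family //= sorted_map.
apply/forallP => b; apply/implyP => _; apply/forallP => i; apply/implyP => _.
by rewrite sorted_map; exact: h.
Qed.

(* The integration variable z^l is the distance from a node of the l-th cell to
   the right endpoint l r of that cell, whereas [intensity] reads its measures
   from the left endpoint: hence the reflection x |-> r - x. *)
Theorem proposition4p1 (R : realType) (k : nat) (hk : (2 <= k)%N)
  (r : R) (hr : 0 < r)
  (lam : nat -> {finite_measure set R -> \bar R})
  (hlam : forall l, (1 <= l <= k)%N -> lam l `<< @lebesgue_measure R)
  (d : measure_display) (Omega : measurableType d) (P : probability Omega R)
  (eta : Omega -> set R)
  (heta : poisson_process P
    (intensity k r (fun l => pushforward (lam l) (fun x => r - x))) eta)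
  (n : nat) (hn : (1 <= n)%N)
  (tau : 'I_n -> R) (htau : forall i, 0 <= tau i <= r) :
  ('E_P[fun w =>
      \prod_(i < n) (sigma_khop k r (eta w) (k%:R * r - tau i))%:R]%R =
   \sum_(p in partition_families k n)
     \int[iprod_measure (fun b : 'I_k.-1 * {set 'I_n} => lam b.1.+1)
            (blocks p)]_(z in
         [set z | forall b, b \in blocks p ->
                    (0 <= (iprod_coord z b : R) <= tau_hat r tau b.2)%R])
       (\prod_(l < k.-1) \prod_(b in p l) \prod_(i in b)
         (sorted <%R [seq (iprod_coord z (m, finset.pblock (p m) i) : R)
                      | m <- enum 'I_k.-1])%:R)%:E)%E.
Proof.
have lam0 l x : (l < k)%N -> lam l.+1 [set x] = 0%E.
  move=> lk; have /null_content_dominatesP := hlam l.+1 lk; apply.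
    exact: measurable_set1.
  exact: lebesgue_measure_set1.
(* Extension by 0 outside the partition families gives a sum of measurable functions over a whole
   finite type. *)
pose C p w := if p \in partition_families k n then
  configs r eta (blockset p) (@block_level k n) (block_box r tau) (block_rel p) w else 0.
have mC p : measurable_fun [set: Omega] (fun w => (C p w)%:E).
  apply/measurable_EFinP; rewrite /C; have [pP|_] := boolP (p \in _) => //.
  apply: (measurable_configs heta).
  - by move=> b; exact: measurable_block_box.
  - by move=> b x [].
  - exact: block_rel_local.
have C0 p w : (0 <= (C p w)%:E)%E.
  rewrite lee_fin /C; case: ifP => // _.
  by apply: config_sum_ge0 => c; exact: box_ind_ge0.
transitivity (\int[P]_w \sum_p (C p w)%:E)%E.
  rewrite unlock.
  (* Outside this null set no node is a multiple of r and no two cells have equal distances, so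
     [prod_sigma_khop] applies. *)
  have := negligibleU
    (negligible_exists (fun m : nat => fixed_node_negligible lam0 heta (m%:R * r)))
    (ties_negligible hr lam0 heta).
  move=> [N [mN N0 badN]].
  apply: (ge0_eq_integral_null mN N0).
  - exact: emeasurable_sum.
  - by move=> w; rewrite lee_fin prodr_ge0.
  - by move=> w; exact: sume_ge0.
  move=> w Nw; rewrite sumEFin; congr EFin; rewrite prod_sigma_khop // ?big_mkcond //.
  - exact: (pp_finite heta w).
  - by move=> m wm; apply: Nw; apply: badN; left; exists m.
  - move=> l l' s s' lk l'k ll' ws ws' zs zs' zz; apply: Nw; apply: badN; right.
    by exists l, l', s, s'.
rewrite ge0_integral_sum // [RHS]big_mkcond; apply: eq_bigr => p _.
rewrite /C; case: ifPn => [pP|_]; last by rewrite integral0.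
rewrite (mean_configs hr heta).
- by rewrite -integral_block_box.
- by move=> b _; rewrite (leq_trans (ltn_ord b.1)) // leq_pred.
- by move=> b; exact: measurable_block_box.
- by move=> b x [].
- exact: block_rel_local.
- exact: block_rel_mono.
- exact: block_rel_sep.
Qed.
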